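(* Let $L\colon TM\to\mathbb{R}$ be a Lagrangian satisfying conditions (S), (G) and (B), let $p,q\in M$ and $c\in\mathbb{R}$. If $\mathcal{N}_{p,q}$ is $c$-bounded, then it is $c$-precompact.
   Context: $M$ is a smooth connected manifold of dimension $m+1$, $m\ge 1$, with a fixed auxiliary complete Riemannian metric $g$ and norm $\|v\|=\sqrt{g(v,v)}$. For a function $L$ on $TM$: $\partial_vL(x,v)[w]:=\frac{d}{ds}L(x,v+sw)|_{s=0}$; in natural coordinates $(x^i,v^i)$ of $TM$, $\partial_xL(x,v)[w]:=\sum_i\frac{\partial L}{\partial x^i}(x,v)w^i$; $\|\partial_vL(x,v)\|$, $\|\partial_xL(x,v)\|$ are the norms of these linear forms with respect to $g_x$. Since $\partial_xL$ depends on coordinates, bounds on $\|\partial_xL\|$ are read in local charts (the locally bounded function $C$ in the bound may depend on the chart). Condition (S): (i) $L\in C^1(TM)$; (ii) there is a $C^1$ vector field $K$ on $M$ such that $L$ is invariant under the local flow $\psi$ of $K$, i.e. $L(\psi(t,x),\partial_x\psi(t,x)[v])=L(x,v)$ whenever defined, and the Noether charge $N(x,v):=\partial_vL(x,v)[K_x]$ has the form $N(x,v)=Q_x(v)+d(x)$ with $Q$ a $C^1$ one-form and $d$ a $C^1$ function on $M$; (iii) $d$ is invariant by the flow of $K$ and $Q_x(K)<0$ for all $x\in M$. Put $L_c(x,v):=L(x,v)-\frac{Q_x(v)^2}{Q_x(K)}$. Condition (G): there are continuous functions $C,\lambda\colon M\to(0,+\infty)$ such that, for all $x\in M$ and $v,v_1,v_2\in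 T_xM$: $L_c(x,v)\le C(x)(\|v\|^2+1)$; $\|\partial_xL_c(x,v)\|\le C(x)(\|v\|^2+1)$; $\|\partial_vL_c(x,v)\|\le C(x)(\|v\|+1)$; $(\partial_vL_c(x,v_2)-\partial_vL_c(x,v_1))[v_2-v_1]\ge\lambda(x)\|v_2-v_1\|^2$. Condition (B): there are constants $c_1,c_2,c_3,k_1,k_2$ such that, for all $x\in M$: $0<c_1\le\lambda(x)$; $L(x,0)\ge c_2$; $\|\partial_vL(x,0)\|\le c_3$; $0<k_1\le -Q_x(K)$; $|d(x)|\le k_2$. Paths: $\Omega^{1,2}_{p,q}$ is the Hilbert manifold of absolutely continuous curves $z\colon[0,1]\to M$ with $\int_0^1 g(\dot z,\dot z)\,ds<+\infty$, $z(0)=p$, $z(1)=q$; $\mathcal{A}(z)=\int_0^1L(z,\dot z)\,ds$ for $z\in\Omega^{1,2}_{p,q}$; $\mathcal{N}_{p,q}:=\{z\in\Omega^{1,2}_{p,q}: N(z,\dot z)\text{ is constant a.e. on }[0,1]\}$; $\mathcal{J}:=\mathcal{A}|_{\mathcal{N}_{p,q}}$; $\mathcal{J}^c:=\{z\in\mathcal{N}_{p,q}:\mathcal{J}(z)\le c\}$. $\mathcal{N}_{p,q}$ is $c$-bounded if $\mathcal{J}^c\ne\emptyset$ and $\sup_{z\in\mathcal{J}^c}|N(z,\dot z)|<+\infty$ ($N(z,\dot z)$ being identified with its a.e. constant value). $\mathcal{N}_{p,q}$ is $c$-precompact if every sequence $(z_n)_n\subset\mathcal{J}^c$ has a uniformly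 convergent subsequence (uniform convergence on $[0,1]$ with respect to the distance of $g$, the limit being a continuous curve in $M$). *)

(* Defs.v *)
From HB Require Import structures.
From mathcomp Require Import all_boot all_order all_algebra.
From mathcomp Require Import all_classical all_reals all_analysis.

Set Implicit Arguments.
Unset Strict Implicit.
Unset Printing Implicit Defensive.

Import Order.TTheory GRing.Theory Num.Theory.
Import numFieldTopology.Exports numFieldNormedType.Exports.

Local Open Scope classical_set_scope.
Local Open Scope ring_scope.

(* In finite dimension this is the usual notion: all the directional
   derivatives up to order k exist and are continuous on U. *)
Fixpoint Ck_on (R : realType) (V W : normedModType R) (k : nat) (U : set V)
    (f : V -> W) : Prop :=
  match k with
  | 0%N => forall x, U x -> {for x, continuous f}
  | k'.+1 => (forall x, U x -> differentiable f x) /\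
             (forall v, Ck_on k' U (fun x => 'D_v f x))
  end.

Definition smooth_on (R : realType) (V W : normedModType R) (U : set V)
    (f : V -> W) : Prop := forall k, Ck_on k U f.

(* [chart_map] and [chart_inv] are total functions, whose values outside
   [chart_dom] and [chart_cod] are irrelevant. *)
Record chart (R : realType) (n : nat) (T : topologicalType) := Chart {
  chart_dom : set T;
  chart_map :> T -> 'rV[R]_n;
  chart_inv : 'rV[R]_n -> T;
  chart_cod := chart_map @` chart_dom;
  chart_dom_open : open chart_dom;
  chart_cod_open : open chart_cod;
  chart_mapK : forall x, chart_dom x -> chart_inv (chart_map x) = x;
  chart_map_cont : forall x, chart_dom x -> {for x, continuous chart_map};
  chart_inv_cont : forall y, chart_cod y -> {for y, continuous chart_inv}
}.

Definition compatible (R : realType) (n : nat) (T : topologicalType)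
    (phi psi : chart R n T) : Prop :=
  smooth_on (phi @` (chart_dom phi `&` chart_dom psi)) (psi \o chart_inv phi) /\
  smooth_on (psi @` (chart_dom phi `&` chart_dom psi)) (phi \o chart_inv psi).

Record manifold (R : realType) (n : nat) := Manifold {
  carrier :> topologicalType;
  atlas : set (chart R n carrier);
  manifold_hausdorff : hausdorff_space carrier;
  manifold_second_countable : @second_countable carrier;
  atlas_cover : forall x, exists phi, atlas phi /\ chart_dom phi x;
  atlas_compatible : forall phi psi, atlas phi -> atlas psi ->
    compatible phi psi;
  atlas_maximal : forall phi, (forall psi, atlas psi -> compatible phi psi) ->
    atlas phi
}.

Definition chart_at (R : realType) (n : nat) (M : manifold R n) (x : M) :
  chart R n M := sval (cid (atlas_cover x)).

(* A vector tangent at x is represented by its components in the chosen chart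
   [chart_at x]; [coord] and [tvec] below convert from and to the components in
   an arbitrary chart.  As [chart_at x] jumps with x, regularity in x is always
   expressed in the components with respect to one fixed chart. *)
Definition tangent (R : realType) (n : nat) (M : manifold R n) (x : M) : Type :=
  'rV[R]_n.

Definition coord (R : realType) (n : nat) (M : manifold R n) (phi : chart R n M)
    (x : M) (v : tangent x) : 'rV[R]_n :=
  'd (phi \o chart_inv (chart_at x)) (chart_at x x) v.

Definition tvec (R : realType) (n : nat) (M : manifold R n) (phi : chart R n M)
    (y : 'rV[R]_n) (u : 'rV[R]_n) : tangent (chart_inv phi y) :=
  'd (chart_at (chart_inv phi y) \o chart_inv phi) y u.

Definition tangent_map (R : realType) (n : nat) (M : manifold R n) (f : M -> M)
    (x : M) (v : tangent x) : tangent (f x) :=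
  'd (chart_at (f x) \o f \o chart_inv (chart_at x)) (chart_at x x) v.

(* Meaningful where [gamma] is continuous; it then exists in [chart_at]
   if and only if it exists in every chart around [gamma t]. *)
Definition velocity (R : realType) (n : nat) (M : manifold R n)
    (gamma : R -> M) (t : R) : tangent (gamma t) :=
  derive1 (chart_at (gamma t) \o gamma) t.

Definition C1_fun (R : realType) (n : nat) (M : manifold R n) (f : M -> R) :
    Prop :=
  forall phi, atlas phi -> Ck_on 1 (chart_cod phi) (f \o chart_inv phi).

Definition C1_vector_field (R : realType) (n : nat) (M : manifold R n)
    (K : forall x : M, tangent x) : Prop :=
  forall phi, atlas phi ->
    Ck_on 1 (chart_cod phi)
      (fun y => coord phi (K (chart_inv phi y))).

Definition C1_one_form (R : realType) (n : nat) (M : manifold R n)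
    (Q : forall x : M, tangent x -> R) : Prop :=
  (forall x (a : R) (v w : tangent x), Q x (a *: v + w) = a * Q x v + Q x w) /\
  (forall phi, atlas phi -> forall u : 'rV[R]_n,
    Ck_on 1 (chart_cod phi) (fun y => Q (chart_inv phi y) (tvec phi y u))).

Definition riemannian_metric (R : realType) (n : nat) (M : manifold R n)
    (g : forall x : M, tangent x -> tangent x -> R) : Prop :=
  [/\ forall x (v w : tangent x), g x v w = g x w v,
      forall x (a : R) (u v w : tangent x),
        g x (a *: u + v) w = a * g x u w + g x v w,
      forall x (v : tangent x), v != 0 -> 0 < g x v v
    & forall phi, atlas phi -> forall u v : 'rV[R]_n,
        smooth_on (chart_cod phi)
          (fun y => g (chart_inv phi y) (tvec phi y u) (tvec phi y v))].

Definition gnorm (R : realType) (n : nat) (M : manifold R n)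
    (g : forall x : M, tangent x -> tangent x -> R) (x : M) (v : tangent x) : R :=
  Num.sqrt (g x v v).

Definition dual_norm (R : realType) (n : nat) (M : manifold R n)
    (g : forall x : M, tangent x -> tangent x -> R) (x : M)
    (l : tangent x -> R) : R :=
  sup [set `|l w| | w in [set w : tangent x | gnorm g w <= 1]].

Definition local_rep (R : realType) (n : nat) (M : manifold R n)
    (L : forall x : M, tangent x -> R) (phi : chart R n M)
    (y u : 'rV[R]_n) : R :=
  L (chart_inv phi y) (tvec phi y u).

Definition C1_lagrangian (R : realType) (n : nat) (M : manifold R n)
    (L : forall x : M, tangent x -> R) : Prop :=
  forall phi, atlas phi ->
    Ck_on 1 [set yu : 'rV[R]_n * 'rV[R]_n | chart_cod phi yu.1]
      (fun yu => local_rep L phi yu.1 yu.2).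

Definition dv (R : realType) (n : nat) (M : manifold R n)
    (L : forall x : M, tangent x -> R) (x : M) (v w : tangent x) : R :=
  derive1 (fun s : R => L x (v + s *: w)) 0.

Definition dx (R : realType) (n : nat) (M : manifold R n)
    (L : forall x : M, tangent x -> R) (phi : chart R n M)
    (x : M) (v w : tangent x) : R :=
  'D_(coord phi w) (fun y => local_rep L phi y (coord phi v)) (phi x).

Definition C1_curve_on (R : realType) (n : nat) (M : manifold R n)
    (U : set R) (gamma : R -> M) : Prop :=
  (forall t, U t -> {for t, continuous gamma}) /\
  (forall phi, atlas phi ->
    Ck_on 1 (U `&` gamma @^-1` chart_dom phi) (phi \o gamma)).

Definition piecewise_C1 (R : realType) (n : nat) (M : manifold R n)
    (a b : R) (gamma : R -> M) : Prop :=
  exists s : seq R, itv_partition a b s /\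
    forall i, (i < size s)%N ->
      let I := `[nth b (a :: s) i, nth b (a :: s) i.+1] in
      exists (U : set R) (eta : R -> M),
        [/\ open U, [set` I] `<=` U, C1_curve_on U eta
          & forall t, t \in I -> eta t = gamma t].

Definition curve_length (R : realType) (n : nat) (M : manifold R n)
    (g : forall x : M, tangent x -> tangent x -> R) (a b : R) (gamma : R -> M) :
    \bar R :=
  (\int[lebesgue_measure]_(t in `[a, b]) (gnorm g (velocity gamma t))%:E)%E.

Definition dist (R : realType) (n : nat) (M : manifold R n)
    (g : forall x : M, tangent x -> tangent x -> R) (x y : M) : \bar R :=
  ereal_inf [set l | exists (a b : R) (gamma : R -> M),
    [/\ piecewise_C1 a b gamma, gamma a = x, gamma b = y
      & l = curve_length g a b gamma]].

Definition complete_metric (R : realType) (n : nat) (M : manifold R n)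
    (g : forall x : M, tangent x -> tangent x -> R) : Prop :=
  forall u : nat -> M,
    (forall e : R, 0 < e -> exists k0, forall i j,
      (k0 <= i)%N -> (k0 <= j)%N -> (dist g (u i) (u j) < e%:E)%E) ->
    exists x : M, forall e : R, 0 < e -> exists k0, forall i,
      (k0 <= i)%N -> (dist g (u i) x < e%:E)%E.

Definition integral_curve (R : realType) (n : nat) (M : manifold R n)
    (K : forall x : M, tangent x) (a b : R) (gamma : R -> M) : Prop :=
  forall t, t \in `]a, b[ ->
    [/\ {for t, continuous gamma},
        derivable (chart_at (gamma t) \o gamma) t 1
      & velocity gamma t = K (gamma t)].

Definition flow_rel (R : realType) (n : nat) (M : manifold R n)
    (K : forall x : M, tangent x) (t : R) (x y : M) : Prop :=
  exists (a b : R) (gamma : R -> M),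
    [/\ 0 \in `]a, b[, t \in `]a, b[, integral_curve K a b gamma,
        gamma 0 = x & gamma t = y].

Definition flow_dom (R : realType) (n : nat) (M : manifold R n)
    (K : forall x : M, tangent x) (t : R) (x : M) : Prop :=
  exists y, flow_rel K t x y.

(* For K of class C^1 the point y is unique, by uniqueness of integral curves,
   and [flow_dom K t] is open. *)
Definition flow (R : realType) (n : nat) (M : manifold R n)
    (K : forall x : M, tangent x) (t : R) (x : M) : M :=
  xget x [set y | flow_rel K t x y].

Definition noether_charge (R : realType) (n : nat) (M : manifold R n)
    (L : forall x : M, tangent x -> R) (K : forall x : M, tangent x)
    (x : M) (v : tangent x) : R :=
  dv L v (K x).

Definition condition_S (R : realType) (n : nat) (M : manifold R n)
    (L : forall x : M, tangent x -> R) (K : forall x : M, tangent x)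
    (Q : forall x : M, tangent x -> R) (d : M -> R) : Prop :=
  [/\ C1_lagrangian L,
      [/\ C1_vector_field K,
          forall t x, flow_dom K t x -> forall v : tangent x,
            L (flow K t x) (tangent_map (flow K t) v) = L x v,
          C1_one_form Q,
          C1_fun d
        & forall x (v : tangent x), noether_charge L K v = Q x v + d x],
      forall t x, flow_dom K t x -> d (flow K t x) = d x
    & forall x, Q x (K x) < 0].

Definition L_c (R : realType) (n : nat) (M : manifold R n)
    (L : forall x : M, tangent x -> R) (K : forall x : M, tangent x)
    (Q : forall x : M, tangent x -> R) (x : M) (v : tangent x) : R :=
  L x v - Q x v ^+ 2 / Q x (K x).

(* The form [dx] depends on the chart, hence so does the bound on it. *)
Definition condition_G (R : realType) (n : nat) (M : manifold R n)
    (g : forall x : M, tangent x -> tangent x -> R)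
    (L : forall x : M, tangent x -> R) (K : forall x : M, tangent x)
    (Q : forall x : M, tangent x -> R) (C lambda : M -> R) : Prop :=
  let Lc := L_c L K Q in
  [/\ [/\ continuous C, continuous lambda, forall x, 0 < C x
        & forall x, 0 < lambda x],
      forall x (v : tangent x), Lc x v <= C x * (gnorm g v ^+ 2 + 1),
      forall phi, atlas phi -> exists C' : M -> R,
        (forall x, chart_dom phi x ->
          exists b : R, \forall y \near x, `|C' y| <= b) /\
        (forall x (v : tangent x), chart_dom phi x ->
          dual_norm g (dx Lc phi v) <= C' x * (gnorm g v ^+ 2 + 1)),
      forall x (v : tangent x),
        dual_norm g (dv Lc v) <= C x * (gnorm g v + 1)
    & forall x (v1 v2 : tangent x),
        lambda x * gnorm g (v2 - v1 : tangent x) ^+ 2 <=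
        dv Lc v2 (v2 - v1) - dv Lc v1 (v2 - v1)].

Definition condition_B (R : realType) (n : nat) (M : manifold R n)
    (g : forall x : M, tangent x -> tangent x -> R)
    (L : forall x : M, tangent x -> R) (K : forall x : M, tangent x)
    (Q : forall x : M, tangent x -> R) (d lambda : M -> R) : Prop :=
  exists c1 c2 c3 k1 k2 : R,
    [/\ 0 < c1, 0 < k1
      & forall x : M,
        [/\ c1 <= lambda x, c2 <= L x 0,
            dual_norm g (dv L (0 : tangent x)) <= c3,
            k1 <= - Q x (K x) & `|d x| <= k2]].

(* Curves defined on [0, 1] are represented by functions on R of which only the
   restriction to [0, 1] matters. *)

Definition absolutely_continuous_on (R : realType) (V : normedModType R)
    (a b : R) (f : R -> V) : Prop :=
  forall e : R, 0 < e -> exists2 delta : R, 0 < delta &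
    forall (k : nat) (s t : 'I_k -> R),
      (forall i, a <= s i /\ s i <= t i /\ t i <= b) ->
      (forall i j, i != j -> t i <= s j \/ t j <= s i) ->
      \sum_(i < k) (t i - s i) < delta ->
      \sum_(i < k) `|f (t i) - f (s i)| < e.

Definition absolutely_continuous_curve (R : realType) (n : nat)
    (M : manifold R n) (z : R -> M) : Prop :=
  {within `[0, 1], continuous z} /\
  (forall phi, atlas phi -> forall a b : R, 0 <= a -> a <= b -> b <= 1 ->
    (forall t, t \in `[a, b] -> chart_dom phi (z t)) ->
    absolutely_continuous_on a b (phi \o z)).

Definition Omega (R : realType) (n : nat) (M : manifold R n)
    (g : forall x : M, tangent x -> tangent x -> R) (p q : M) : set (R -> M) :=
  [set z | [/\ absolutely_continuous_curve z,
    (\int[lebesgue_measure]_(s in `[0%R, 1%R])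
       (g (z s) (velocity z s) (velocity z s))%:E < +oo)%E,
    z 0 = p & z 1 = q]].

(* The action, as an extended real; finite on [Omega] under the conditions (S)
   and (G). *)
Definition action (R : realType) (n : nat) (M : manifold R n)
    (L : forall x : M, tangent x -> R) (z : R -> M) : \bar R :=
  (\int[lebesgue_measure]_(s in `[0%R, 1%R]) (L (z s) (velocity z s))%:E)%E.

Definition noether_constant (R : realType) (n : nat) (M : manifold R n)
    (L : forall x : M, tangent x -> R) (K : forall x : M, tangent x)
    (z : R -> M) (k : R) : Prop :=
  {ae lebesgue_measure, forall s : R, s \in `[0, 1] ->
    noether_charge L K (velocity z s) = k}.

Definition Npq (R : realType) (n : nat) (M : manifold R n)
    (g : forall x : M, tangent x -> tangent x -> R)
    (L : forall x : M, tangent x -> R) (K : forall x : M, tangent x)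
    (p q : M) : set (R -> M) :=
  [set z | Omega g p q z /\ exists k, noether_constant L K z k].

Definition Jsub (R : realType) (n : nat) (M : manifold R n)
    (g : forall x : M, tangent x -> tangent x -> R)
    (L : forall x : M, tangent x -> R) (K : forall x : M, tangent x)
    (p q : M) (c : R) : set (R -> M) :=
  [set z | Npq g L K p q z /\ (action L z <= c%:E)%E].

Definition c_bounded (R : realType) (n : nat) (M : manifold R n)
    (g : forall x : M, tangent x -> tangent x -> R)
    (L : forall x : M, tangent x -> R) (K : forall x : M, tangent x)
    (p q : M) (c : R) : Prop :=
  Jsub g L K p q c !=set0 /\
  exists b : R, forall z, Jsub g L K p q c z ->
    forall k, noether_constant L K z k -> `|k| <= b.

Definition c_precompact (R : realType) (n : nat) (M : manifold R n)
    (g : forall x : M, tangent x -> tangent x -> R)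
    (L : forall x : M, tangent x -> R) (K : forall x : M, tangent x)
    (p q : M) (c : R) : Prop :=
  forall z : nat -> R -> M, (forall i, Jsub g L K p q c (z i)) ->
  exists (sigma : nat -> nat) (zeta : R -> M),
    [/\ {homo sigma : i j / (i < j)%N},
        {within `[0, 1], continuous zeta}
      & forall e : R, 0 < e -> exists i0, forall i, (i0 <= i)%N ->
          forall t, t \in `[0, 1] ->
            (dist g (z (sigma i) t) (zeta t) < e%:E)%E].

(* Main.v *)
(** On a curve of J^c the Noether charge is a constant k with |k| <= b, so that
    Q(z') = k - d(z) is bounded and L(z, z') differs from L_c(z, z') by a bounded
    amount.  Strong convexity of L_c on the fibres and (B) then give constants
    with L(z, z') >= alpha |z'|^2 - beta, and the action bounds the energy:
    d(z s, z t) <= kap (t - s) + (c + beta) / (alpha kap) for every kap > 0,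
    which makes J^c equicontinuous.

    To pass from the velocity of an absolutely continuous curve to distances, let
    F be a function on M that is infinitesimally nonexpansive, e.g. the distance
    to a point.  Then F o z is absolutely continuous, it is the integral of its
    a.e. derivative (bounded variation, Stieltjes measures and Radon-Nikodym), and
    that derivative is at most |z'| a.e.

    Given a sequence in J^c and a free ultrafilter on the indices, the set of
    times at which the sequence converges along the ultrafilter contains 0, is
    closed by completeness and open by local compactness, hence is [0, 1].
    Equicontinuity makes the convergence uniform along the ultrafilter, and a
    uniformly convergent subsequence can be extracted. *)
Require Import Defs.
From HB Require Import structures.
From mathcomp Require Import all_boot all_order all_algebra.
From mathcomp Require Import all_classical all_reals all_analysis measurable_realfun.
From mathcomp Require Import lra ring.
Set Implicit Arguments.
Unset Strict Implicit.
Unset Printing Implicit Defensive.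
Import Order.TTheory GRing.Theory Num.Theory.
Import numFieldTopology.Exports numFieldNormedType.Exports.
Local Open Scope classical_set_scope.
Local Open Scope ring_scope.

(** [dist] is an infimum over piecewise C^1 curves, whereas the curves of J^c are only absolutely
    continuous, so their own length cannot be inserted into the infimum. Testing with a real
    function F avoids approximating them by admissible curves, since only F o z has to be
    integrated. The same device, applied to piecewise C^1 curves, yields the triangle inequality,
    the symmetry of the distance and its comparison with the topology of M.

    A tangent vector is stored by its components in [chart_at x], which jumps with x. Speed and
    Lagrangian along a curve are therefore never shown to be measurable; their integrals are treated
    as lower integrals, and each estimate passes through the integrable density of F o z.

    The bound with the free parameter kap is what remains of the Cauchy-Schwarz inequality when the
    square of that density is not known to be integrable. Its second term is small for kap large and
    its first for t close to s, so that kap is fixed by the required accuracy before t - s. *)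

Local Notation gnorm := Defs.gnorm.

(** * Lower integrals *)

Section lower_integral.
Local Open Scope ereal_scope.
Context d (T : measurableType d) (R : realType).
Variable mu : {measure set T -> \bar R}.
Import HBNNSimple.
(* The integral of a nonnegative function is a supremum over the simple
   functions below it, hence a lower integral when the function is not
   measurable: monotonicity survives without any measurability. *)
Lemma ae_ge0_le_lower_integral (D : set T) (f1 f2 : T -> \bar R) :
  measurable D -> (forall x, D x -> 0 <= f1 x) -> (forall x, D x -> 0 <= f2 x) ->
  {ae mu, forall x, D x -> f1 x <= f2 x} ->
  \int[mu]_(x in D) f1 x <= \int[mu]_(x in D) f2 x.
Proof.
move=> mD f10 f20 [N [mN N0 subN]].
rewrite !ge0_integralE//; apply: ge_ereal_sup => _ [s /= sf1 <-].
(* Cutting s off on the null set N does not change its integral and puts it below f2 everywhere. *)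
pose s' := proj_nnsfun s (measurableC mN).
apply: le_trans (_ : sintegral mu s' <= _).
  rewrite -[leLHS]integralT_nnsfun -[leRHS]integralT_nnsfun.
  rewrite (@ge0_negligible_integral _ _ _ _ _ N)//; first last.
  - by move=> x _; rewrite lee_fin.
  - by apply/measurable_EFinP; exact: measurable_funTS.
  rewrite [leRHS](@ge0_negligible_integral _ _ _ _ _ N)//; first last.
  - by move=> x _; rewrite lee_fin.
  - by apply/measurable_EFinP; exact: measurable_funTS.
  rewrite le_eqVlt; apply/orP; left; apply/eqP; apply: eq_integral => x.
  by rewrite inE /= => -[_ Nx]; rewrite /s'/= mindicE mem_set// mulr1.
apply: ereal_sup_ubound; exists s' => //= x.
rewrite mindicE; have [/[!inE] Nx|] := boolP (x \in ~` N); last first.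
  by move=> _; rewrite mulr0; apply: erestrict_ge0.
rewrite mulr1; apply: le_trans (sf1 x) _.
rewrite !patchE; case: ifPn => // /[!inE] Dx.
by apply: contrapT => nle; apply: Nx; apply: subN => /= /(_ Dx).
Qed.

(** The integral is the difference of the lower integrals of the positive and negative parts, the
    first monotone in the function and the second antitone. *)
Lemma ae_le_lower_integral (D : set T) (f1 f2 : T -> \bar R) :
  measurable D -> {ae mu, forall x, D x -> f1 x <= f2 x} ->
  \int[mu]_(x in D) f1 x <= \int[mu]_(x in D) f2 x.
Proof.
move=> mD f12; rewrite integralE [leRHS]integralE; apply: leeB.
- apply: ae_ge0_le_lower_integral => //; apply: filterS f12 => x /[apply] h.
  by apply: (@funepos_le _ _ [set x] f1 f2) => [t|]; rewrite inE// => ->.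
- apply: ae_ge0_le_lower_integral => //; apply: filterS f12 => x /[apply] h.
  by apply: (@funeneg_le _ _ [set x] f1 f2) => [t|]; rewrite inE// => ->.
Qed.

(** Additivity in the domain is applied to the simple functions below f, which are measurable even
    when f is not. *)
Lemma lower_integral_setU_le (D1 D2 : set T) (f : T -> \bar R) :
  measurable D1 -> measurable D2 -> [disjoint D1 & D2] ->
  (forall x, (D1 `|` D2) x -> 0 <= f x) ->
  \int[mu]_(x in D1 `|` D2) f x <= \int[mu]_(x in D1) f x + \int[mu]_(x in D2) f x.
Proof.
move=> mD1 mD2 D12 f0; rewrite {1}ge0_integralE//; apply: ge_ereal_sup => _ [s /= sf <-].
have ms D : measurable_fun D (EFin \o s).
  by apply/measurable_EFinP; exact: measurable_funTS.
have sD D : measurable D -> D `<=` D1 `|` D2 ->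
    \int[mu]_(x in D) (s x)%:E <= \int[mu]_(x in D) f x.
  move=> mD DD; apply: ae_ge0_le_lower_integral => //.
  - by move=> x _; rewrite lee_fin.
  - by move=> x /DD/f0.
  - by apply: aeW => x /DD Dx; have := sf x; rewrite patchE mem_set.
apply: le_trans (leeD (sD _ mD1 (@subsetUl _ _ _)) (sD _ mD2 (@subsetUr _ _ _))).
rewrite -ge0_integral_setU//; last by move=> x _; rewrite lee_fin.
rewrite -integralT_nnsfun [leRHS]integral_mkcond.
rewrite le_eqVlt; apply/orP; left; apply/eqP; apply: eq_integral => x _.
rewrite patchE; case: ifPn => // xD; apply/eqP; rewrite eq_le lee_fin.
have := sf x; rewrite patchE (negbTE xD) lee_fin => ->.
exact: fun_ge0.
Qed.
End lower_integral.

(** * Absolutely continuous functions *)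

Section ac_sequences.
Context {R : realType}.
Implicit Types (a b e del : R) (f : R -> R) (p : R * R) (s r : seq (R * R)).
Definition segments_in a b s :=
  all (fun p => [&& a <= p.1, p.1 <= p.2 & p.2 <= b]) s.
Definition apart p q := (p.2 <= q.1) || (q.2 <= p.1).
Definition total_length s := \sum_(p <- s) (p.2 - p.1).
Definition total_increment f s := \sum_(p <- s) `|f p.2 - f p.1|.
(** Families of segments are lists, which can be refined by induction, and the bound is not strict,
    so that it survives the suprema in the total variation. *)
Definition ac_at a b f e del := forall s, segments_in a b s ->
  pairwise apart s -> total_length s < del -> total_increment f s <= e.
Definition ac_seq a b f := forall e, 0 < e -> exists2 del, 0 < del & ac_at a b f e del.
Lemma apartC p q : apart p q = apart q p.
Proof. by rewrite /apart orbC. Qed.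

Fixpoint steps a (t : seq R) : seq (R * R) :=
  if t is x :: t' then (a, x) :: steps x t' else [::].
Lemma variation_steps a b f t : itv_partition a b t ->
  variation a b f t = total_increment f (steps a t).
Proof.
rewrite /total_increment; elim: t a b => // [a b|h t ih a b].
  by rewrite /itv_partition /= => -[_ /eqP <-]; rewrite /variation/= !big_nil.
rewrite /itv_partition /variation => -[]/= /andP[ah ht] /eqP htb.
rewrite big_nat_recl//= big_cons/=; congr +%R.
have /ih : itv_partition h b t by split => //; exact/eqP.
by rewrite /variation => ->.
Qed.

Lemma steps_in a b t : itv_partition a b t -> segments_in a b (steps a t).
Proof.
elim: t a => //= x t ih a pt.
have [/= /andP[ax xt] _] := pt; have := itv_partition_cons pt => pxt.
have xb := itv_partition_le pxt.
rewrite lexx (ltW ax) xb /=; apply/allP => p pin.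
have /allP/(_ _ pin)/and3P[h1 h2 h3] := ih _ pxt.
by rewrite h2 h3 !andbT (le_trans (ltW ax)).
Qed.

Lemma steps_apart a b t : itv_partition a b t -> pairwise apart (steps a t).
Proof.
elim: t a => //= x t ih a pt; have pxt := itv_partition_cons pt.
rewrite ih// andbT; apply/allP => p pin.
have /allP/(_ _ pin)/and3P[h1 h2 h3] := steps_in pxt.
by rewrite /apart /= h1.
Qed.

Lemma steps_length a b t : itv_partition a b t ->
  total_length (steps a t) = b - a.
Proof.
rewrite /total_length; elim: t a => [|x t ih] a pt /=.
  by rewrite big_nil (itv_partition_nil pt) subrr.
by rewrite big_cons (ih _ (itv_partition_cons pt)) /=; ring.
Qed.

Lemma steps_cross a b t (q : R * R) : itv_partition a b t ->
  apart (a, b) q -> all (apart ^~ q) (steps a t).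
Proof.
move=> pt; rewrite /apart /= => abq; apply/allP => p pin.
have /allP/(_ _ pin)/and3P[h1 h2 h3] := steps_in pt.
by case/orP: abq => h; rewrite /apart; [rewrite (le_trans h3)|rewrite (le_trans h) ?orbT].
Qed.

Local Open Scope ereal_scope.
(* Replacing segments by partitions of them keeps a family admissible, so the
   segments in s may be exhausted one at a time by their variations. *)
Lemma ac_total_variation a b f e del : ac_at a b f e del -> forall s r,
  segments_in a b (s ++ r) -> pairwise apart (s ++ r) ->
  (total_length (s ++ r) < del)%R ->
  \sum_(p <- s) total_variation p.1 p.2 f + (total_increment f r)%:E <= e%:E.
Proof.
move=> H; elim=> [r inr apr lenr|p s ih r]; first by rewrite big_nil add0e lee_fin H.
rewrite /= => /andP[/and3P[ap pp pb]] insr /andP[allp apsr].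
move=> lensr; rewrite /total_length big_cons in lensr.
rewrite big_cons -addeA.
set rest := (X in _ + X).
have rest0 : 0 <= rest.
  apply: adde_ge0.
    move: insr; rewrite /segments_in all_cat => /andP[/allP ins _].
    rewrite big_seq; apply: sume_ge0 => q /ins/and3P[_ h _].
    exact: total_variation_ge0.
  by rewrite lee_fin sumr_ge0.
have reste : rest <= e%:E.
  apply: ih => //; apply: le_lt_trans lensr; rewrite /total_length.
  by rewrite lerDr subr_ge0.
(* Finiteness allows [rest] to change sides, so that the supremum over the partitions of p can be
   bounded one partition at a time. *)
have restf : rest \is a fin_num.
  by rewrite ge0_fin_numE// (le_lt_trans reste) ?ltry.
rewrite -leeBrDr//; apply: ge_ereal_sup => _ [_ [t pt <-] <-].
rewrite leeBrDr// variation_steps// addeCA -EFinD.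
have -> : (total_increment f (steps p.1 t) + total_increment f r =
   total_increment f (steps p.1 t ++ r))%R by rewrite /total_increment big_cat.
have stin := steps_in pt.
apply: ih.
- move: insr; rewrite /segments_in !all_cat => /andP[-> ->]; rewrite andbT/=.
  apply/allP => q /(allP stin)/and3P[h1 h2 h3].
  by rewrite (le_trans ap h1) h2 (le_trans h3 pb).
- move: apsr allp; rewrite !pairwise_cat all_cat => /and3P[h1 h2 h3] /andP[h4 h5].
  apply/and3P; split=> //.
  + rewrite allrel_catr h1 andbT; apply/allrelP => x y xs yst.
    have := allP h4 _ xs; rewrite (surjective_pairing p) => /(steps_cross pt)/allP/(_ _ yst).
    by rewrite apartC.
  + apply/and3P; split => //; last exact: steps_apart pt.
    apply/allrelP => x y xst yr; have := allP h5 _ yr.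
    by rewrite (surjective_pairing p) => /(steps_cross pt)/allP/(_ _ xst).
- move: lensr; rewrite /total_length !big_cat/=.
  have := steps_length pt; rewrite /total_length => ->.
  by rewrite addrCA.
Qed.

(** For e = 1 the variation is at most 1 on segments shorter than [del], and finitely many segments
    of length del / 2 cover [a, b]; half of [del], as the condition on lengths is strict. *)
Lemma ac_bounded_variation a b f : (a <= b)%R -> ac_seq a b f ->
  total_variation a b f < +oo.
Proof.
move=> ab acf; have [del del0 H] := acf 1%R ltr01.
have short x y : (a <= x)%R -> (x <= y)%R -> (y <= b)%R -> (y - x < del)%R ->
    total_variation x y f <= 1%:E.
  move=> ax xy yb yx.
  have := @ac_total_variation _ _ _ _ _ H [:: (x, y)] [::].
  rewrite /= /total_length /total_increment !big_seq1 !big_nil adde0 /= andbT ax xy yb /=.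
  exact.
have step n : forall x, (a <= x)%R -> (x <= b)%R -> (x - a <= n%:R * (del / 2))%R ->
    total_variation a x f <= n%:R%:E.
  elim: n => [|n ih] x ax xb xn.
    have -> : x = a by lra.
    by rewrite total_variationxx.
  have [xa|xa] := leP (x - a)%R (n%:R * (del / 2))%R.
    by apply: le_trans (ih _ ax xb xa) _; rewrite lee_fin ler_nat.
  pose y := (a + n%:R * (del / 2))%R.
  have n0 : (0 <= n%:R * (del / 2))%R by rewrite mulr_ge0// divr_ge0// ltW.
  have ay : (a <= y)%R by rewrite /y; lra.
  have yx : (y <= x)%R by rewrite /y; lra.
  rewrite (total_variationD f ay yx) -natr1 EFinD leeD//.
    by apply: ih => //; rewrite /y; lra.
  by apply: short => //; move: xn; rewrite -natr1 mulrDl mul1r /y; lra.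
apply: le_lt_trans (ltry _); apply: (step (Num.trunc ((b - a) / (del / 2))).+1) => //.
rewrite -ler_pdivrMr ?divr_gt0//; exact/ltW/truncnS_gt.
Qed.
End ac_sequences.

Section ac_monotone_parts.
Context {R : realType}.
Implicit Types (a b e del : R) (f : R -> R).
Lemma ac_seq_continuous_le a b f : ac_seq a b f -> forall e, 0 < e ->
  exists2 del, 0 < del & forall x y, a <= x -> x <= y -> y <= b -> y - x < del ->
    `|f y - f x| <= e.
Proof.
move=> acf e e0; have [del del0 H] := acf e e0; exists del => // x y ax xy yb yx.
have := H [:: (x, y)]; rewrite /segments_in /total_length /total_increment /= !big_seq1 /=.
by rewrite ax xy yb; apply.
Qed.

Lemma ac_total_variation_fin_num a b f x y : ac_seq a b f -> a <= x -> x <= y -> y <= b ->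
  total_variation x y f \is a fin_num.
Proof.
move=> acf ax xy yb; apply/bounded_variationP => //.
have ab : a <= b by rewrite (le_trans ax)// (le_trans xy).
apply: (bounded_variationl xy yb); apply: (bounded_variationr ax) => //.
  exact: le_trans yb.
apply/bounded_variationP => //; rewrite ge0_fin_numE ?total_variation_ge0//.
exact: ac_bounded_variation.
Qed.

(** Increments of the variation function are variations on segments, so this is [ac_total_variation]
    with an empty second list. *)
Lemma ac_seq_total_variation a b f : a <= b -> ac_seq a b f ->
  ac_seq a b (fine \o total_variation a ^~ f).
Proof.
move=> ab acf e e0; have [del del0 H] := acf e e0; exists del => // s ins aps lens.
have := @ac_total_variation _ _ _ _ _ _ H s [::]; rewrite cats0 => /(_ ins aps lens).
rewrite /total_increment big_nil adde0 -lee_fin; apply: le_trans.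
rewrite -sumEFin big_seq [leRHS]big_seq; apply: lee_sum => p /(allP ins)/and3P[ap pp pb].
have fin (x y : R) := @ac_total_variation_fin_num a b f x y acf.
rewrite /= (total_variationD f ap pp) fineD ?fin ?(le_trans pp pb)//.
rewrite addrC addKr ger0_norm ?fine_ge0 ?total_variation_ge0// fineK ?fin//.
Qed.

Lemma ac_seqB a b f g : ac_seq a b f -> ac_seq a b g -> ac_seq a b (f \- g).
Proof.
move=> acf acg e e0; have e20 : 0 < e / 2 by rewrite divr_gt0.
have [d1 d10 H1] := acf _ e20; have [d2 d20 H2] := acg _ e20.
exists (Num.min d1 d2); first by rewrite lt_min d10.
move=> s ins aps; rewrite lt_min => /andP[l1 l2].
rewrite (splitr e); apply: le_trans (lerD (H1 s ins aps l1) (H2 s ins aps l2)).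
rewrite /total_increment -big_split /=; apply: ler_sum => p _.
have -> : f p.2 - g p.2 - (f p.1 - g p.1) = (f p.2 - f p.1) - (g p.2 - g p.1) by ring.
exact: ler_normB.
Qed.
End ac_monotone_parts.

(** * Densities of monotone functions *)

Section ac_nondecreasing.
Context {R : realType}.
Variables (a b : R) (ab : a <= b) (f : R -> R).
Hypothesis ndf : {in `[a, b] &, nondecreasing_fun f}.
Hypothesis acf : ac_seq a b f.
Notation mu := (@lebesgue_measure R).
(** The projection of R onto [a, b]: composing with it extends f by constants to a cumulative
    function on R. *)
Definition clamp (x : R) : R := Num.max a (Num.min b x).
Lemma clamp_in x : a <= clamp x <= b.
Proof. by rewrite /clamp le_max lexx ge_max ab ge_min lexx. Qed.

Lemma clampE x : a <= x <= b -> clamp x = x.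
Proof. by move=> /andP[ax xb]; rewrite /clamp (min_idPr xb) (max_idPr ax). Qed.

Lemma le_clamp x y : x <= y -> clamp x <= clamp y.
Proof.
move=> xy; rewrite /clamp ge_max le_max lexx /= le_max; apply/orP; right.
by rewrite le_min ge_min lexx /= ge_min xy orbT.
Qed.

Lemma clamp_dist x y : x <= y -> clamp y - clamp x <= y - x.
Proof.
move=> xy; rewrite /clamp /Order.max /Order.min.
by have [bx|bx] := ltP b x; have [yb|yb] := ltP b y; do ?case: ltP => ?; lra.
Qed.

Let F := f \o clamp.
Let ndF : nondecreasing F.
Proof. by move=> x y xy; apply: ndf; rewrite ?in_itv/= ?clamp_in ?le_clamp. Qed.

Let F_continuous : continuous F.
Proof.
move=> x; apply/cvgrPdist_le => e e0.
have [del del0 H] := ac_seq_continuous_le acf e0.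
near=> y; have yx : `|y - x| < del by near: y; apply/nbhs_ballP; exists del => // z; rewrite /ball/= distrC.
have [cx1 cx2] := andP (clamp_in x); have [cy1 cy2] := andP (clamp_in y).
rewrite /F /=; have [xy|xy] := leP x y.
  rewrite distrC; apply: H => //; first exact: le_clamp.
  by apply: le_lt_trans (clamp_dist xy) _; rewrite -(ger0_norm (_ : 0 <= y - x)) ?subr_ge0.
apply: H => //; first exact/le_clamp/ltW.
apply: le_lt_trans (clamp_dist (ltW xy)) _.
by rewrite -(ger0_norm (_ : 0 <= x - y)) ?subr_ge0 1?ltW// distrC.
Unshelve. all: by end_near. Qed.

Let cF : cumulative R R :=
  HB.pack F (isCumulative.Build R _ R F ndF (right_continuousW F_continuous)).
Local Notation nu := (lebesgue_stieltjes_measure cF).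
Let nu_oc (x y : R) : x <= y -> nu `]x, y]%classic = (F y - F x)%:E.
Proof.
move=> xy; rewrite /lebesgue_stieltjes_measure /measure_extension.
by rewrite measurable_mu_extE/=; [rewrite wlength_itv_bnd|exact: is_ocitv].
Qed.

Let le_nu (A B : set R) : measurable A -> measurable B -> A `<=` B -> (nu A <= nu B)%E.
Proof.
move=> mA mB AB; apply: (@le_measure _ _ _ [the {measure set (measurableTypeR R) -> \bar R} of nu]) => //; rewrite inE; [exact: mA|exact: mB].
Qed.

Let le_mu (A B : set R) : measurable A -> measurable B -> A `<=` B -> (mu A <= mu B)%E.
Proof.
move=> mA mB AB; apply: (@le_measure _ _ _ [the {measure set (measurableTypeR R) -> \bar R} of mu]) => //; rewrite inE; [exact: mA|exact: mB].
Qed.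

(** U is a disjoint union of countably many open intervals, which are bounded and hence have end
    points. The mass of each is at most the increment of f between its clamped end points, so
    absolute continuity bounds every finite partial sum. *)
Let nu_small (U : set R) e del : open U -> U `<=` `](a - 1), (b + 1)[%classic ->
  ac_at a b f e del -> (mu U < del%:E)%E -> (nu U <= e%:E)%E.
Proof.
move=> oU Uab H muU; pose I := open_disjoint_itv oU.
have mI n : measurable (I n) by apply: open_measurable; exact: open_disjoint_itv_open.
have IU n : I n `<=` U by rewrite (open_disjoint_itv_bigcup oU); exact: bigcup_sup.
have bndI n x : I n x -> a - 1 < x < b + 1 by move=> /IU/Uab; rewrite /= in_itv.
have supI n : I n !=set0 -> has_sup (I n).
  by move=> I0; split=> //; exists (b + 1) => x /bndI/andP[_ /ltW].
have infI n : I n !=set0 -> has_inf (I n).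
  by move=> I0; split=> //; exists (a - 1) => x /bndI/andP[/ltW].
(* An empty component gets the segment (a, a), which is apart from every segment in [a, b]. *)
pose p n := if pselect (I n !=set0) then (clamp (inf (I n)), clamp (sup (I n)))
  else (a, a).
have inf_sup n : I n !=set0 -> inf (I n) <= sup (I n).
  move=> I0; case: (I0) => x Ix; apply: (@le_trans _ _ x).
    by apply: ge_inf => //; case: (infI n I0).
  by apply: sup_upper_bound => //; exact: supI.
have inp n : [&& a <= (p n).1, (p n).1 <= (p n).2 & (p n).2 <= b].
  rewrite /p; case: pselect => /= I0; last by rewrite !lexx.
  have [-> _] := andP (clamp_in (inf (I n))); have [_ ->] := andP (clamp_in (sup (I n))).
  by rewrite le_clamp// inf_sup.
have nup n : (nu (I n) <= `|f (p n).2 - f (p n).1|%:E)%E.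
  rewrite /p; case: pselect => /= I0; last first.
    have -> : I n = set0 by case: (eqVneq (I n) set0) => // /set0P /I0.
    by rewrite measure0 lee_fin.
  apply: (@le_trans _ _ (nu `](inf (I n)), (sup (I n))]%classic)).
    apply: le_nu => // x Ix; rewrite /= in_itv /=; apply/andP; split; last first.
      by apply: sup_upper_bound => //; exact: supI.
    (* I n is open, so its infimum is not attained and ]inf, sup] contains it. *)
    have := @open_disjoint_itv_open _ _ oU n; rewrite openE => /(_ x Ix)/nbhs_ballP[r /= r0 rI].
    apply: (@le_lt_trans _ _ (x - r / 2)); last by rewrite ltrBlDr ltrDl divr_gt0.
    apply: ge_inf; first by case: (infI n I0).
    by apply: rI; rewrite /ball /= opprB addrC subrK gtr0_norm ?divr_gt0// ltr_pdivrMr// ltr_pMr// ltr1n.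
  by rewrite nu_oc ?inf_sup// lee_fin ler_norm.
have mup n : (((p n).2 - (p n).1)%:E <= mu (I n))%E.
  rewrite /p; case: pselect => /= I0; last by rewrite subrr measure_ge0.
  apply: (@le_trans _ _ (sup (I n) - inf (I n))%:E).
    by rewrite lee_fin clamp_dist// inf_sup.
  apply: (@le_trans _ _ (mu `](inf (I n)), (sup (I n))[%classic)).
    rewrite lebesgue_measure_itv /= lte_fin; case: ltP => //.
    by rewrite -subr_le0 lee_fin.
  apply: le_mu => // x; rewrite /= in_itv/= => /andP[ix xs].
  have [y Iy yx] : exists2 y, I n y & y < x.
    have [|y Iy] := @inf_adherent _ (I n) (x - inf (I n)) _ (infI n I0); first by rewrite subr_gt0.
    by rewrite addrC subrK; exists y.
  have [z Iz xz] : exists2 z, I n z & x < z.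
    have [|z Iz] := @sup_adherent _ (I n) (sup (I n) - x) _ (supI n I0); first by rewrite subr_gt0.
    by rewrite subKr; exists z.
  by apply: (@open_disjoint_itv_is_interval _ _ oU _ _ _ Iy Iz); rewrite (ltW yx) (ltW xz).
have apartp n k : n != k -> apart (p n) (p k).
  move=> nk; rewrite /apart.
  have [an pn nb] := and3P (inp n); have [ak pk kb] := and3P (inp k).
  move: an pn nb ak pk kb.
  rewrite /p; case: pselect => /= I0 an pn nb; case: pselect => /= J0 ak pk kb; last 3 first.
  - by rewrite an orbT.
  - by rewrite ak.
  - by rewrite lexx.
  have disj z : I n z -> I k z -> False.
    move=> Iz Jz; move/eqP: nk; apply.
    by apply: (@open_disjoint_itv_trivIset _ _ oU) => //; exists z.
  have [x Ix] := I0; have [y Jy] := J0.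
  (* Disjoint intervals are ordered as any two of their points: otherwise a point near the supremum
     of the left one and a point near the infimum of the right one would force a common point. *)
  have [xy|yx|xy] := ltgtP x y; last by exfalso; apply: (disj x) => //; rewrite xy.
    apply/orP; left; apply: le_clamp; rewrite leNgt; apply/negP => lt.
    have [|x' Ix' x'lt] := @sup_adherent _ (I n) (sup (I n) - inf (I k)) _ (supI n I0); first by rewrite subr_gt0.
    rewrite subKr in x'lt.
    have [|y' Jy' y'lt] := @inf_adherent _ (I k) (x' - inf (I k)) _ (infI k J0); first by rewrite subr_gt0.
    rewrite addrC subrK in y'lt.
    have [y'x|xy'] := leP y' x.
      by apply: (disj x) => //; apply: (@open_disjoint_itv_is_interval _ _ oU _ _ _ Jy' Jy); rewrite y'x ltW.
    by apply: (disj y') => //; apply: (@open_disjoint_itv_is_interval _ _ oU _ _ _ Ix Ix'); rewrite (ltW xy') ltW.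
  apply/orP; right; apply: le_clamp; rewrite leNgt; apply/negP => lt.
  have [|y' Jy' y'lt] := @sup_adherent _ (I k) (sup (I k) - inf (I n)) _ (supI k J0); first by rewrite subr_gt0.
  rewrite subKr in y'lt.
  have [|x' Ix' x'lt] := @inf_adherent _ (I n) (y' - inf (I n)) _ (infI n I0); first by rewrite subr_gt0.
  rewrite addrC subrK in x'lt.
  have [x'y|yx'] := leP x' y.
    by apply: (disj y) => //; apply: (@open_disjoint_itv_is_interval _ _ oU _ _ _ Ix' Ix); rewrite x'y ltW.
  by apply: (disj x') => //; apply: (@open_disjoint_itv_is_interval _ _ oU _ _ _ Jy Jy'); rewrite (ltW yx') ltW.
have tI := @open_disjoint_itv_trivIset _ _ oU.
have mU : measurable (\bigcup_n I n) by apply: bigcup_measurable.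
rewrite (open_disjoint_itv_bigcup oU) measure_semi_bigcup//; apply: lime_le.
  by apply: is_cvg_nneseries.
apply: nearW => k.
have := H [seq p i | i <- iota 0 k].
have -> : segments_in a b [seq p i | i <- iota 0 k].
  by apply/allP => _ /mapP[i _ ->]; exact: inp.
have -> : pairwise apart [seq p i | i <- iota 0 k].
  rewrite pairwise_map; apply: (@sub_pairwise _ [rel i j | i != j]).
    by move=> i j /= /apartp.
  by rewrite -uniq_pairwise iota_uniq.
rewrite /total_length /total_increment !big_map => /(_ isT isT) len.
apply: (@le_trans _ _ (\sum_(0 <= i < k) `|f (p i).2 - f (p i).1|%:E)%E).
  by apply: lee_sum => i _; exact: nup.
rewrite sumEFin lee_fin /index_iota subn0; apply: len.
rewrite -lte_fin; apply: le_lt_trans muU.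
rewrite (open_disjoint_itv_bigcup oU) measure_semi_bigcup//.
apply: (@le_trans _ _ (\sum_(0 <= i < k) mu (I i))%E); last exact: nneseries_lim_ge.
rewrite -sumEFin /index_iota subn0; apply: lee_sum => i _; exact: mup.
Qed.

(** Outer regularity encloses A in an open set of Lebesgue measure less than [del], to which
    [nu_small] applies. *)
Let nu_null (A : set R) : measurable A -> A `<=` `]a, b]%classic -> mu A = 0%E -> nu A = 0%E.
Proof.
move=> mA Aab muA; apply/eqP; rewrite eq_le measure_ge0 andbT.
apply/lee_addgt0Pr => e e0; rewrite add0e.
have [del del0 H] := acf e0.
have muA' : (mu A < +oo)%E by rewrite muA ltry.
have [U [oU AU muU]] := lebesgue_regularity_outer mA muA' del0.
(* Only the part of U near [a, b] is kept, as [nu_small] needs bounded components. *)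
pose V := U `&` `](a - 1), (b + 1)[%classic.
have oV : open V by apply: openI => //; exact: interval_open.
have mV : measurable V by exact: open_measurable.
have mU : measurable U by exact: open_measurable.
apply: (@le_trans _ _ (nu V)).
  apply: le_nu => // x Ax; split; first exact: AU.
  by have := Aab _ Ax; rewrite /= !in_itv/= => /andP[h1 h2]; apply/andP; split; lra.
apply: nu_small H _ => //.
  exact: subIsetr.
apply: le_lt_trans muU.
have -> : mu V = (mu (V `\` A) + mu (V `&` A))%E.
  exact: (@measureDI _ _ _ [the {measure set (measurableTypeR R) -> \bar R} of mu] _ _ mV mA).
rewrite (_ : mu (V `&` A) = 0%E) ?adde0; last first.
  apply/eqP; rewrite eq_le measure_ge0 andbT -muA le_mu//; exact: measurableI.
apply: le_mu; [exact: measurableD|exact: measurableD|].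
by apply: setSD; exact: subIsetl.
Qed.

(** h is the density of the Stieltjes measure restricted to ]a, b], the set on which [nu_null] gives
    domination by Lebesgue measure. *)
Lemma ac_nondecreasing_integral : exists h : R -> R,
  mu.-integrable setT (EFin \o h) /\
  (forall s t, a <= s -> s <= t -> t <= b ->
     f t - f s = \int[mu]_(x in `]s, t]) h x).
Proof.
have nuoo : (nu `]a, b]%classic < +oo)%E by rewrite nu_oc// ltry.
pose nu' : {finite_measure set (measurableTypeR R) -> \bar R} :=
  @mfrestr _ (measurableTypeR R) R `]a, b]%classic nu (measurable_itv `]a, b]) nuoo.
have nu'mu : nu' `<< mu.
  apply/null_content_dominatesP => A mA muA.
  rewrite /nu' /= /mfrestr /mrestr; apply: nu_null => //; first exact: measurableI.
  apply/eqP; rewrite eq_le measure_ge0 andbT -muA le_mu//; exact: measurableI.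
have [h [h0 hfin inth hE]] := radon_nikodym_sigma_finite nu'mu.
have hK : EFin \o (fine \o h) = h by apply/funext => x /=; rewrite fineK.
exists (fine \o h); rewrite hK; split=> // s t as_ st tb.
rewrite /Rintegral -[X in integral _ _ X]/(EFin \o (fine \o h)) hK.
rewrite -hE// /nu' /= /mfrestr /mrestr setIidl; last first.
  by apply: subset_itv; rewrite bnd_simp.
by rewrite nu_oc//= /F /= !clampE// ?as_ ?tb ?(le_trans st)// ?(le_trans as_).
Qed.
End ac_nondecreasing.

(** Continuous induction: the supremum of the t with [P a t] would be passed if it were smaller than
    b. It serves to glue estimates made in charts and, later, to propagate convergence along
    [0, t]. *)
Lemma itv_local_global (R : realType) (a b : R) (P : R -> R -> Prop) : a <= b ->
  (forall x y z, a <= x -> x <= y -> y <= z -> z <= b -> P x y -> P y z -> P x z) ->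
  (forall x, a <= x <= b -> exists2 e, 0 < e & forall s t, a <= s -> s <= t -> t <= b ->
     x - e < s -> t < x + e -> P s t) -> P a b.
Proof.
move=> ab glue loc; pose S := [set t | a <= t <= b /\ P a t].
have Sa : S a.
  split; first by rewrite lexx ab.
  have [|e e0] := loc a; first by rewrite lexx.
  by apply; rewrite ?lexx// ?ltrBlDr ltrDl.
have supS : has_sup S by split; [exists a|exists b => t [/andP[]]].
have xab : a <= sup S <= b.
  rewrite sup_upper_bound//= sup_le_ub//; first by exists a.
  by move=> t [/andP[]].
have [e e0 H] := loc _ xab.
have [s [/andP[as_ sb] Pas] sx] := sup_adherent e0 supS.
have sS : s <= sup S by apply: sup_upper_bound => //; split=> //; rewrite as_.
pose t := Num.min b (sup S + e / 2).
have e2 : 0 < e / 2 by rewrite divr_gt0.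
have [/andP[aS Sb]] := xab.
have st : s <= t by rewrite /t le_min sb (le_trans sS)// lerDl ltW.
have tb : t <= b by rewrite /t ge_min lexx.
have Pat : P a t.
  apply: glue Pas _ => //; apply: H => //.
  by rewrite /t gt_min; apply/orP; right; lra.
have : t <= sup S.
  by apply: sup_upper_bound => //; split => //; rewrite (le_trans as_ st).
rewrite {1}/t ge_min => /orP[bS|]; last by lra.
by have -> : b = t by apply/eqP; rewrite eq_le tb andbT /t le_min lexx /=; lra.
Qed.

Section ac_integral.
Context {R : realType}.
Notation mu := (@lebesgue_measure R).
Implicit Types (a b : R) (f G : R -> R).
(** Jordan decomposition f = T - (T - f), with T the variation function: both parts are
    nondecreasing and absolutely continuous, and their densities are subtracted. *)
Lemma ac_integral a b f : a <= b -> ac_seq a b f -> exists h : R -> R,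
  mu.-integrable setT (EFin \o h) /\
  (forall s t, a <= s -> s <= t -> t <= b ->
     f t - f s = \int[mu]_(x in `]s, t]) h x).
Proof.
move=> ab acf; pose T := fine \o total_variation a ^~ f.
have acT := ac_seq_total_variation ab acf.
have fin (x y : R) := @ac_total_variation_fin_num R a b f x y acf.
have TE x y : a <= x -> x <= y -> y <= b -> T y - T x = fine (total_variation x y f).
  move=> ax xy yb; rewrite /T /= (total_variationD f ax xy) fineD ?fin ?(le_trans xy yb)//.
  by rewrite addrC addKr.
have ndT : {in `[a, b] &, nondecreasing_fun T}.
  move=> x y; rewrite !in_itv/= => /andP[ax xb] /andP[ay yb] xy.
  by rewrite -subr_ge0 TE// fine_ge0// total_variation_ge0.
have ndTf : {in `[a, b] &, nondecreasing_fun (T \- f)}.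
  move=> x y; rewrite !in_itv/= => /andP[ax xb] /andP[ay yb] xy.
  have h : f y - f x <= T y - T x.
    rewrite TE//; apply: le_trans (ler_norm _) _.
    by rewrite -lee_fin fineK ?fin// total_variation_ge.
  by rewrite /=; lra.
have [h1 [i1 H1]] := ac_nondecreasing_integral ab ndT acT.
have [h2 [i2 H2]] := ac_nondecreasing_integral ab ndTf (ac_seqB acT acf).
have sub (h : R -> R) (i : interval R) : mu.-integrable setT (EFin \o h) ->
  mu.-integrable [set` i] (EFin \o h).
  by move=> ih; apply: (integrableS measurableT).
exists (h1 \- h2); split.
  have -> : EFin \o (h1 \- h2) = (fun x => (h1 x)%:E - (h2 x)%:E)%E
    by apply/funext => x /=; rewrite EFinB.
  exact: (integrableB measurableT i1 i2).
move=> s t as_ st tb; rewrite RintegralB//; [|exact: sub|exact: sub].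
by rewrite -H1// -H2//=; ring.
Qed.

(** Near an interior point f is f a plus the indefinite integral of h, and Lebesgue differentiation
    applies. *)
Lemma ac_ae_derive a b f (h : R -> R) : mu.-integrable setT (EFin \o h) ->
  (forall s t, a <= s -> s <= t -> t <= b -> f t - f s = \int[mu]_(x in `]s, t]) h x) ->
  {ae mu, forall t, a < t < b -> derivable f t 1 /\ derive1 f t = h t}.
Proof.
move=> ih hE.
have sub (i : interval R) : mu.-integrable [set` i] (EFin \o h).
  by apply: (integrableS measurableT).
have loch : locally_integrable setT h.
  by have := integrable_locally measurableT ih; rewrite patch_setT.
have := @FTC1 R h (BRight a) (fun y => sub _) loch.
apply: filterS; first exact: (ae_filter_ringOfSetsType mu).
move=> t H /andP[at_ tb].
have [|dF FE] := H; first by [].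
set F := (fun _ => _) in dF FE.
have near_eq : {near t, f =1 cst (f a) \+ F}.
  have : \forall x \near t, x \in `]a, b[ by apply: near_in_itvoo; rewrite in_itv/= at_.
  apply: filterS => x; rewrite in_itv/= => /andP[ax xb].
  by rewrite /= /F -hE ?lexx ?ltW//; ring.
have dG : is_derive t 1 (cst (f a) \+ F) (h t).
  rewrite -[h t]add0r; apply: is_deriveD.
  by rewrite -FE derive1E; apply: derivableP.
have eq1 : {near t, cst (f a) \+ F =1 f} by apply: filterS near_eq => x ->.
have [df dfE] := near_eq_is_derive eq1 dG.
by split=> //; rewrite derive1E.
Qed.
End ac_integral.

(** The modulus of z at e / C serves for f at e. This is used for the coordinates of a curve and for
    functions that are Lipschitz in a chart. *)
Lemma absolutely_continuous_ac_seq (R : realType) (V : normedModType R) (a b C : R)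
    (z : R -> V) (f : R -> R) : absolutely_continuous_on a b z -> 0 < C ->
  (forall s t, a <= s <= b -> a <= t <= b -> `|f t - f s| <= C * `|z t - z s|) ->
  ac_seq a b f.
Proof.
move=> acz C0 fz e e0; have eC0 : 0 < e / C by rewrite divr_gt0.
have [del del0 H] := acz _ eC0; exists del => // s ins aps lens.
pose p i := nth (0, 0) s i.
have insp i : (i < size s)%N -> [&& a <= (p i).1, (p i).1 <= (p i).2 & (p i).2 <= b].
  by move=> si; apply: (allP ins); exact: mem_nth.
have := H (size s) (fun i => (p i).1) (fun i => (p i).2).
have E (F : R * R -> R) : \sum_(i < size s) F (p i) = \sum_(q <- s) F q.
  by rewrite (big_nth (0, 0)) big_mkord.
rewrite (E (fun q => q.2 - q.1)) (E (fun q => `|z q.2 - z q.1|)) => {}H.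
have {}H : \sum_(q <- s) `|z q.2 - z q.1| < e / C.
  apply: H => //.
    by move=> i; have /and3P[-> -> ->] := insp i (ltn_ord i).
  move=> i j ij; move/(pairwiseP (0, 0)) : (aps) => Hp; have [lt|lt|eq] := ltngtP i j; last by move/eqP: ij; case; apply: val_inj.
    by have /orP[h|h] := Hp i j (ltn_ord i) (ltn_ord j) lt; [left|right].
  by have /orP[h|h] := Hp j i (ltn_ord j) (ltn_ord i) lt; [right|left].
apply: (@le_trans _ _ (C * \sum_(q <- s) `|z q.2 - z q.1|)); last first.
  by rewrite -ler_pdivlMl// mulrC ltW.
rewrite mulr_sumr /total_increment big_seq [leRHS]big_seq.
apply: ler_sum => q /(allP ins)/and3P[h1 h2 h3].
by apply: fz; apply/andP; split=> //; [exact: le_trans h3|exact: le_trans h2].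
Qed.

(** * Increments bounded by integrals *)

Section derivative_bound.
Context {R : realType}.
Notation mu := (@lebesgue_measure R).
Implicit Types (a b : R) (f G : R -> R).
(* Only the derivative h of f has to be measurable, not the bound G; thus the
   speed of a curve may be used as G without proving it measurable. *)
Definition ae_derivative_bound a b f G := exists h : R -> R,
  [/\ mu.-integrable setT (EFin \o h),
      forall s t, a <= s -> s <= t -> t <= b ->
        f t - f s = \int[mu]_(x in `]s, t]) h x
    & {ae mu, forall t, a < t < b -> `|h t| <= G t}].
Lemma ae_derivative_bound_local a b f G : a <= b -> ac_seq a b f ->
  {ae mu, forall t, a < t < b -> derivable f t 1 -> `|derive1 f t| <= G t} ->
  ae_derivative_bound a b f G.
Proof.
move=> ab acf fG; have [h [ih hE]] := ac_integral ab acf.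
exists h; split=> //; have := ac_ae_derive ih hE; move: fG.
apply: filterS2; first exact: (ae_filter_ringOfSetsType mu).
by move=> t H1 H2 tab; have [d <-] := H2 tab; exact: H1.
Qed.

Let integrable_itv (h : R -> R) (i : interval R) : mu.-integrable setT (EFin \o h) ->
  mu.-integrable [set` i] (EFin \o h).
Proof. by move=> ih; apply: (integrableS measurableT). Qed.

Let ae_neq (c : R) : {ae mu, forall t, t != c}.
Proof.
exists [set c]; split => //; first exact: lebesgue_measure_set1.
by move=> x /= /negP; rewrite negbK => /eqP.
Qed.

Let ae_itvoo a b : {ae mu, forall t, t \in `[a, b] -> a < t < b}.
Proof.
have := ae_neq b; have := ae_neq a.
apply: filterS2; first exact: (ae_filter_ringOfSetsType mu).
by move=> t ta tb; rewrite in_itv/= !lt_neqAle => /andP[-> ->]; rewrite eq_sym ta tb.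
Qed.

Lemma ae_derivative_bound_glue a b c f G : a <= b -> b <= c ->
  ae_derivative_bound a b f G -> ae_derivative_bound b c f G ->
  ae_derivative_bound a c f G.
Proof.
move=> ab bc [h1 [i1 H1 G1]] [h2 [i2 H2 G2]].
pose h t := if t <= b then h1 t else h2 t.
have E1 s t : t <= b -> \int[mu]_(x in `]s, t]) h x = \int[mu]_(x in `]s, t]) h1 x.
  move=> tb; apply: eq_Rintegral => x; rewrite inE/= in_itv/= => /andP[_ xt].
  by rewrite /h (le_trans xt tb).
have E2 s t : b <= s -> \int[mu]_(x in `]s, t]) h x = \int[mu]_(x in `]s, t]) h2 x.
  move=> bs; apply: eq_Rintegral => x; rewrite inE/= in_itv/= => /andP[sx _].
  by rewrite /h leNgt (le_lt_trans bs sx).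
have ih : mu.-integrable setT (EFin \o h).
  have mb : measurable `]-oo, b]%classic by [].
  have -> : EFin \o h = (fun x => ((EFin \o h1) \_ `]-oo, b]) x +
      ((EFin \o h2) \_ (~` `]-oo, b])) x)%E.
    apply/funext => x /=; rewrite /h !patchE.
    have [xb|xb] := leP x b.
      by rewrite mem_set/= ?in_itv//= memNset/= ?adde0//; apply; rewrite /= in_itv.
    rewrite memNset/= ?in_itv/= ?leNgt ?xb// mem_set/= ?add0e//.
    by rewrite in_itv/= leNgt xb.
  apply: (integrableD measurableT).
    exact: (@integrable_mkcond _ (measurableTypeR R) R mu _ (EFin \o h1) mb).1 (integrable_itv `]-oo, b] i1).
  apply: (@integrable_mkcond _ (measurableTypeR R) R mu _ (EFin \o h2) (measurableC mb)).1.
  by apply: (integrableS measurableT) => //; exact: measurableC.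
exists h; split=> //.
  move=> s t as_ st tc; have [tb|bt] := leP t b; first by rewrite E1// H1.
  have [bs|sb] := leP b s; first by rewrite E2// H2.
  have := @Rintegral_itvB R h (BRight s) (BRight t) b (integrable_itv _ ih).
  rewrite !bnd_simp => /(_ (ltW sb) (ltW bt)).
  rewrite (E1 s b)// (E2 b t)// -H1 ?(ltW sb)// -H2 ?(ltW bt)//; lra.
move: G1 G2 (ae_neq b).
apply: filterS3; first exact: (ae_filter_ringOfSetsType mu).
move=> t g1 g2 tb /andP[at_ tc]; rewrite /h.
case: (ltgtP t b) tb => // tb _.
  by apply: g1; rewrite at_.
by apply: g2; rewrite tb.
Qed.

Lemma ae_derivative_bound_le_integral a b f G : a <= b ->
  ae_derivative_bound a b f G ->
  (`|f b - f a|%:E <= \int[mu]_(t in `[a, b]) (G t)%:E)%E.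
Proof.
move=> ab [h [ih hE hG]]; rewrite (hE a b)//.
have iab := integrable_itv `[a, b] ih.
apply: (@le_trans _ _ (\int[mu]_(t in `[a, b]) `|h t|%:E)%E); last first.
  apply: ae_le_lower_integral => //.
  move: hG (ae_itvoo a b).
  apply: filterS2; first exact: (ae_filter_ringOfSetsType mu).
  by move=> t g /[apply] tab; rewrite lee_fin g.
rewrite Rintegral_itv_obnd_cbnd; last exact: integrable_itv.
apply: (@le_trans _ _ (\int[mu]_(t in `[a, b]) `|h t|)%:E).
  by rewrite lee_fin; apply: le_normr_Rintegral.
by rewrite /Rintegral fineK// integrable_fin_num//; exact: integrable_abse iab.
Qed.

(* On ]s, t] the inequality 2 kap |h| <= h^2 + kap^2 replaces Cauchy-Schwarz. *)
Lemma ae_derivative_bound_energy (f G Lam : R -> R) (alpha beta c kap s t : R) :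
  ae_derivative_bound 0 1 f G ->
  0 < alpha -> 0 < kap ->
  {ae mu, forall x, 0 < x < 1 -> alpha * G x ^+ 2 - beta <= Lam x} ->
  (\int[mu]_(x in `[0%R, 1%R]) (Lam x)%:E <= c%:E)%E ->
  0 <= s -> s <= t -> t <= 1 ->
  `|f t - f s| <= kap * (t - s) + (c + beta) / (alpha * kap).
Proof.
move=> [h [ih hE hG]] al0 kap0 Lamge Lamc s0 st t1.
(* An integrable minorant of Lam: alpha G^2 is at least alpha h^2 >= alpha kap (|h| - kap) on ]s, t]
   and at least 0 elsewhere. It is linear in |h| because h^2 is not known to be integrable. *)
pose k (x : R) := alpha * kap * (`|h x| - kap) * \1_`]s, t] x - beta.
have mst : measurable (`]s, t]%classic : set R) by [].
have iabs : mu.-integrable setT (EFin \o (fun x => `|h x|)).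
  exact: integrable_abse ih.
have icst (D : set R) r : measurable D -> (mu D < +oo)%E -> mu.-integrable D (EFin \o cst r).
  move=> mD Doo; apply: measurable_bounded_integrable => //.
  by exists `|r|; split; [exact: num_real|move=> M rM x _; exact: ltW].
have m01 : (mu `[0%R, 1%R]%classic < +oo)%E.
  by rewrite lebesgue_measure_itv /= lte_fin ltr01 -EFinB ltry.
have mstE : mu `]s, t]%classic = (t - s)%:E.
  rewrite lebesgue_measure_itv /= lte_fin; case: ltP => [_|ts]; first by rewrite EFinB.
  have -> : t - s = 0 by apply/eqP; rewrite subr_eq0 eq_le ts st.
  by [].
have cstE (D : set R) r l : measurable D -> mu D = l%:E ->
    \int[mu]_(x in D) (cst r x) = r * l.
  move=> mD Dl; have /= -> := @Rintegral_cst _ _ _ mu D mD r.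
  by congr (_ * _); rewrite -[l]/(fine l%:E); congr fine; exact: Dl.
pose u (x : R) := alpha * kap * (`|h x| - kap).
have iu : mu.-integrable `]s, t] (EFin \o u).
  have -> : EFin \o u = (fun x => (alpha * kap)%:E * (`|h x|%:E - kap%:E))%E.
    by apply/funext => x; rewrite /u /= -EFinB -EFinM.
  apply: integrableZl => //; apply: integrableB => //.
    exact: integrable_itv.
  by apply: icst => //; rewrite mstE ltry.
have iu' : mu.-integrable `[0%R, 1%R] (EFin \o (u \_ `]s, t])).
  rewrite -restrict_EFin; apply: (integrableS measurableT) => //.
  exact: (@integrable_mkcond _ (measurableTypeR R) R mu _ (EFin \o u) mst).1.
have kE : k = (u \_ `]s, t]) \- cst beta.
  apply/funext => x; rewrite /k /= patchE indicE.
  by case: (_ \in _) => /=; rewrite ?mulr1 ?mulr0.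
have ib : mu.-integrable `[0%R, 1%R] (EFin \o cst beta) by exact: icst.
have ik : mu.-integrable `[0%R, 1%R] (EFin \o k).
  have -> : EFin \o k = (fun x => ((u \_ `]s, t]) x)%:E - (cst beta x)%:E)%E.
    by apply/funext => x; rewrite kE /= EFinB.
  exact: integrableB.
have kLam : (\int[mu]_(x in `[0%R, 1%R]) (k x)%:E <= c%:E)%E.
  apply: le_trans Lamc; apply: ae_le_lower_integral => //.
  move: hG Lamge (ae_itvoo 0 1).
  apply: filterS3; first exact: (ae_filter_ringOfSetsType mu).
  move=> x g1 g2 /[apply] x01.
  rewrite lee_fin; apply: le_trans (g2 x01).
  have {}g1 := g1 x01.
  rewrite /k lerD2r; have hh : `|h x| ^+ 2 <= G x ^+ 2.
    by rewrite ler_pXn2r// ?nnegrE// (le_trans _ g1).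
  have h2 := sqr_ge0 (`|h x|).
  have : kap * (`|h x| - kap) <= `|h x| ^+ 2 by nra.
  have : 0 <= `|h x| ^+ 2 by [].
  rewrite indicE; case: (_ \in _) => v0 v /=; rewrite ?mulr1 ?mulr0; last first.
    by rewrite mulr_ge0 ?(ltW al0) ?(le_trans v0 hh).
  by rewrite -mulrA ler_pM2l// (le_trans v).
have intk : \int[mu]_(x in `[0%R, 1%R]) k x =
    alpha * kap * (\int[mu]_(x in `]s, t]) `|h x|) - alpha * kap ^+ 2 * (t - s) - beta.
  rewrite kE RintegralB// (cstE _ _ 1)//; last first.
    by rewrite lebesgue_measure_itv /= lte_fin ltr01 -EFinB subr0.
  rewrite mulr1.
  congr (_ - _); rewrite -Rintegral_mkcondr setIidr; last first.
    by apply: subset_itv; rewrite bnd_simp.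
  have ihst := integrable_itv `]s, t] iabs.
  have ikst : mu.-integrable `]s, t] (EFin \o cst kap) by apply: icst => //; rewrite mstE ltry.
  have iB : mu.-integrable `]s, t] (EFin \o (fun x => `|h x| - kap)).
    have -> : EFin \o (fun x => `|h x| - kap) = (fun x => `|h x|%:E - (cst kap x)%:E)%E.
      by apply/funext => x; rewrite /= EFinB.
    exact: integrableB.
  rewrite RintegralZl//.
  rewrite RintegralB// (cstE _ _ _ mst mstE); ring.
have fh : `|f t - f s| <= \int[mu]_(x in `]s, t]) `|h x|.
  by rewrite hE//; apply: le_normr_Rintegral => //; exact: integrable_itv.
have : \int[mu]_(x in `[0%R, 1%R]) k x <= c.
  by rewrite -lee_fin /Rintegral fineK// integrable_fin_num.
rewrite intk => kc; apply: le_trans fh _.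
rewrite -(ler_pM2l (mulr_gt0 al0 kap0)) mulrDr [X in _ <= _ + X]mulrC divfK ?gt_eqF ?mulr_gt0//.
by move: (Rintegral _ _ _) kc => I kc; clear -kc; lra.
Qed.
End derivative_bound.

(** * Charts and the metric in coordinates *)

Section preliminaries.
Context {R : realType}.
Lemma cvg_bigsum (T : Type) (F : set_system T) {FF : Filter F} (I : Type)
    (s : seq I) (u : I -> T -> R) (l : I -> R) :
  (forall i, u i x @[x --> F] --> l i) ->
  (\sum_(i <- s) u i x) @[x --> F] --> \sum_(i <- s) l i.
Proof.
move=> ul; elim: s => [|i s ih].
  under eq_fun do rewrite big_nil.
  by rewrite big_nil; exact: cvg_cst.
under eq_fun do rewrite big_cons.
by rewrite big_cons; apply: cvgD.
Qed.

Lemma compact_closed_ball_row (n : nat) (c : 'rV[R]_n) (r : R) :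
  compact [set y : 'rV[R]_n | `|y - c| <= r].
Proof.
apply: bounded_closed_compact.
  exists (`|c| + r); split; first exact: num_real.
  move=> b rb y /= yr; apply: ltW; apply: le_lt_trans rb.
  by rewrite -[y](subrK c) addrC; apply: le_trans (ler_normD _ _) _; rewrite lerD2l.
rewrite (_ : mkset _ = (fun y : 'rV[R]_n => `|y - c|) @^-1` [set v | v <= r])//.
apply: closed_comp => [y _|]; last exact: closed_le.
apply: (@continuous_comp _ _ _ (fun y : 'rV[R]_n => y - c) (fun w => `|w|)); last first.
  exact: norm_continuous.
exact: (@cvgB _ _ _ (nbhs y) _ id (cst c) y c cvg_id (cvg_cst _)).
Qed.

Lemma half_lower_bound (a A A0 N q : R) : a * N <= A0 -> q * N <= a / 2 * N ->
  - (q * N) <= A - A0 -> a / 2 * N <= A.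
Proof. by move=> *; lra. Qed.

Lemma normr_coord (n : nat) (w : 'rV[R]_n) i : `|w 0 i| <= `|w|.
Proof.
rewrite -[leRHS]/(mx_norm w) mx_normrE; apply/bigmax_geP; right => /=.
by exists (0, i).
Qed.

Lemma cvg_coord (T : Type) (F : set_system T) {FF : Filter F} (n : nat)
    (w : T -> 'rV[R]_n) (v : 'rV[R]_n) i : w x @[x --> F] --> v -> w x 0 i @[x --> F] --> v 0 i.
Proof.
move=> wv; apply: (@continuous_cvg _ _ _ F FF w (fun N : 'rV[R]_n => N 0 i) v) => //.
exact: coord_continuous.
Qed.

Lemma near_eq_diff (V W : normedModType R) (f h : V -> W) (a v : V) :
  differentiable f a -> {near a, f =1 h} -> differentiable h a ->
  'd f a v = 'd h a v.
Proof. by move=> df fh dh; rewrite -!deriveE//; exact: near_eq_derive. Qed.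

Lemma diff_compE (U V W : normedModType R) (f : U -> V) (h : V -> W) x v :
  differentiable f x -> differentiable h (f x) ->
  'd h (f x) ('d f x v) = 'd (h \o f) x v.
Proof. by move=> df dh; rewrite (diff_comp df dh). Qed.
End preliminaries.

Section charts.
Variables (R : realType) (m : nat) (M : manifold R m.+1).
Local Notation n := m.+1.
Implicit Types (phi psi : chart R n M) (x : M) (y w : 'rV[R]_n).
Lemma chart_at_atlas x : atlas (chart_at x).
Proof. by rewrite /chart_at; case: cid => /= phi []. Qed.

Lemma chart_at_dom x : chart_dom (chart_at x) x.
Proof. by rewrite /chart_at; case: cid => /= phi []. Qed.

Lemma chart_cod_map phi x : chart_dom phi x -> chart_cod phi (phi x).
Proof. by move=> dx; exists x. Qed.

Lemma chart_inv_dom phi y : chart_cod phi y -> chart_dom phi (chart_inv phi y).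
Proof. by move=> [x dx <-]; rewrite chart_mapK. Qed.

Lemma chart_invK phi y : chart_cod phi y -> phi (chart_inv phi y) = y.
Proof. by move=> [x dx <-]; rewrite chart_mapK. Qed.

Lemma near_chart_dom phi x : chart_dom phi x -> \forall x' \near x, chart_dom phi x'.
Proof. by move=> dx; apply: open_nbhs_nbhs; split=> //; exact: chart_dom_open. Qed.

Lemma near_chart_cod phi y : chart_cod phi y -> \forall y' \near y, chart_cod phi y'.
Proof. by move=> dx; apply: open_nbhs_nbhs; split=> //; exact: chart_cod_open. Qed.

Lemma transition_C1 phi psi : atlas phi -> atlas psi ->
  Ck_on 1 (phi @` (chart_dom phi `&` chart_dom psi)) (psi \o chart_inv phi).
Proof. by move=> aphi apsi; case: (atlas_compatible aphi apsi) => H _; exact: H. Qed.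

Lemma transition_differentiable phi psi y : atlas phi -> atlas psi ->
  chart_cod phi y -> chart_dom psi (chart_inv phi y) ->
  differentiable (psi \o chart_inv phi) y.
Proof.
move=> aphi apsi cy dy; have [/(_ y) + _] := transition_C1 aphi apsi.
apply; exists (chart_inv phi y); last exact: chart_invK.
by split=> //; exact: chart_inv_dom.
Qed.

Lemma near_chart_inv_dom phi psi y : chart_cod phi y ->
  chart_dom psi (chart_inv phi y) ->
  \forall y' \near y, chart_cod phi y' /\ chart_dom psi (chart_inv phi y').
Proof.
move=> cy dy; apply: filterI; first exact: near_chart_cod.
have := chart_inv_cont cy => /(_ (chart_dom psi)); apply.
exact: near_chart_dom.
Qed.

(** Chain rule for two transition maps whose composite is the identity near y. It makes [tvec phi y]
    injective, on which the positivity of the metric in coordinates rests. *)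
Lemma transitionK phi psi y w : atlas phi -> atlas psi -> chart_cod phi y ->
  chart_dom psi (chart_inv phi y) ->
  'd (phi \o chart_inv psi) (psi (chart_inv phi y)) ('d (psi \o chart_inv phi) y w) = w.
Proof.
move=> aphi apsi cy dy.
have d1 := transition_differentiable aphi apsi cy dy.
have d2 : differentiable (phi \o chart_inv psi) ((psi \o chart_inv phi) y).
  apply: transition_differentiable => //; first exact: chart_cod_map.
  by rewrite /= chart_mapK//; exact: chart_inv_dom.
have dc := differentiable_comp d1 d2.
have E : {near y, (phi \o chart_inv psi) \o (psi \o chart_inv phi) =1 id}.
  apply: filterS (near_chart_inv_dom cy dy) => y' [cy' dy'] /=.
  by rewrite chart_mapK// chart_invK.
have di : differentiable (id : 'rV[R]_n -> 'rV[R]_n) y by [].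
by rewrite (diff_compE w d1 d2) (near_eq_diff _ dc E di) diff_val.
Qed.

Lemma chart_continuous_comp phi (z : R -> M) t : chart_dom phi (z t) ->
  {for t, continuous z} -> {for t, continuous (phi \o z)}.
Proof.
by move=> dz cz; apply: continuous_comp => //; exact: chart_map_cont.
Qed.

(** [velocity] is taken in the chart chosen at z t, which jumps with t; the chain rule expresses it
    by the derivative in one fixed chart. *)
Lemma velocityE phi (z : R -> M) t : atlas phi -> chart_dom phi (z t) ->
  {for t, continuous z} -> derivable (phi \o z) t 1 ->
  velocity z t = 'd (chart_at (z t) \o chart_inv phi) (phi (z t)) (derive1 (phi \o z) t).
Proof.
move=> aphi dz cz dphi; rewrite /velocity.
have d1 : differentiable (phi \o z) t by exact/derivable1_diffP.
have ex : chart_inv phi (phi (z t)) = z t by rewrite chart_mapK.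
have d2 : differentiable (chart_at (z t) \o chart_inv phi) ((phi \o z) t).
  apply: transition_differentiable => //; [exact: chart_at_atlas|exact: chart_cod_map|].
  by rewrite /= ex; exact: chart_at_dom.
have dc := differentiable_comp d1 d2.
have E : {near t, (chart_at (z t) \o chart_inv phi) \o (phi \o z) =1 chart_at (z t) \o z}.
  have h : \forall s \near t, chart_dom phi (z s) := cz _ (near_chart_dom dz).
  by apply: filterS h => s /= ds; rewrite chart_mapK.
by rewrite derive1E -(near_eq_derive _ E) deriveE// -(diff_compE _ d1 d2) derive1E'.
Qed.

Section metric.
Variable g : forall x : M, tangent x -> tangent x -> R.
Hypothesis hg : riemannian_metric g.
(** The metric as a quadratic form in the components of one fixed chart, where it is jointly
    continuous in point and vector. *)
Definition chart_sqnorm phi y w : R :=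
  g (tvec phi y w) (tvec phi y w).
Lemma sqnorm_velocity phi (z : R -> M) t : atlas phi -> chart_dom phi (z t) ->
  {for t, continuous z} -> derivable (phi \o z) t 1 ->
  g (velocity z t) (velocity z t) = chart_sqnorm phi (phi (z t)) (derive1 (phi \o z) t).
Proof.
move=> aphi dz cz dphi; have E := velocityE aphi dz cz dphi.
rewrite E /chart_sqnorm /tvec.
have e := chart_mapK dz.
rewrite e.
reflexivity.
Qed.

Let gC x (v w : tangent x) : g v w = g w v. Proof. by case: hg. Qed.

Let gDl x (a : R) (u v w : tangent x) : g (a *: u + v : 'rV[R]_n) w = a * g u w + g v w.
Proof. by case: hg. Qed.

Let g0l x (w : tangent x) : g (0 : 'rV[R]_n) w = 0.
Proof.
have := @gDl x 1 0 0 w; rewrite scaler0 addr0 mul1r => /eqP.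
by rewrite -subr_eq subrr eq_sym => /eqP.
Qed.

Lemma metric_ge0 x (v : tangent x) : 0 <= g v v.
Proof.
have [->|v0] := eqVneq (v : 'rV[R]_n) 0; first by rewrite g0l.
by case: hg => _ _ pos _; exact/ltW/pos.
Qed.

Lemma metric_suml x (I : Type) (s : seq I) (a : I -> R) (v : I -> 'rV[R]_n) (w : tangent x) :
  g (\sum_(i <- s) a i *: v i : tangent x) w = \sum_(i <- s) a i * g (v i : tangent x) w.
Proof. by elim: s => [|i s ih]; rewrite ?big_nil ?g0l// !big_cons gDl ih. Qed.

Definition metric_coef phi (i j : 'I_n) y : R :=
  g (tvec phi y 'e_i) (tvec phi y 'e_j).
Lemma chart_sqnormE phi y w :
  chart_sqnorm phi y w = \sum_i \sum_j w 0 i * w 0 j * metric_coef phi i j y.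
Proof.
have E : tvec phi y w = \sum_i w 0 i *: (tvec phi y 'e_i : 'rV[R]_n).
  by rewrite {1}(row_sum_delta w) /tvec raddf_sum; apply: eq_bigr => i _; exact: linearZ_LR.
rewrite /chart_sqnorm {1}E metric_suml; apply: eq_bigr => i _.
rewrite gC E metric_suml mulr_sumr; apply: eq_bigr => j _.
by rewrite gC -mulrA.
Qed.

Lemma chart_sqnormZ phi y (a : R) w :
  chart_sqnorm phi y (a *: w) = a ^+ 2 * chart_sqnorm phi y w.
Proof.
rewrite !chart_sqnormE mulr_sumr; apply: eq_bigr => i _.
rewrite mulr_sumr; apply: eq_bigr => j _; rewrite !mxE; ring.
Qed.

Lemma chart_sqnorm_ge0 phi y w : 0 <= chart_sqnorm phi y w.
Proof. exact: metric_ge0. Qed.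

Lemma chart_sqnorm_gt0 phi y w : atlas phi -> chart_cod phi y -> w != 0 ->
  0 < chart_sqnorm phi y w.
Proof.
move=> aphi cy w0; case: hg => _ _ pos _; apply: pos; apply/eqP => e0.
set psi := chart_at (chart_inv phi y).
have := @transitionK phi psi y w aphi (chart_at_atlas _) cy (chart_at_dom _).
rewrite -[X in 'd _ _ X]/(tvec phi y w) e0 linear0 => /esym/eqP.
exact/negP.
Qed.

Lemma metric_coef_continuous phi i j y : atlas phi -> chart_cod phi y ->
  {for y, continuous (metric_coef phi i j)}.
Proof. by move=> aphi cy; case: hg => _ _ _ /(_ phi aphi 'e_i 'e_j 0%N); apply. Qed.

Lemma cvg_chart_sqnorm phi (T : Type) (F : set_system T) {FF : Filter F}
    (y : T -> 'rV[R]_n) (w : T -> 'rV[R]_n) y0 w0 : atlas phi -> chart_cod phi y0 ->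
  y t @[t --> F] --> y0 -> w t @[t --> F] --> w0 ->
  chart_sqnorm phi (y t) (w t) @[t --> F] --> chart_sqnorm phi y0 w0.
Proof.
move=> aphi cy yy0 ww0; rewrite chart_sqnormE; under eq_fun do rewrite chart_sqnormE.
apply: cvg_bigsum => i; apply: cvg_bigsum => j.
apply: cvgM; first by apply: cvgM; exact: cvg_coord.
by apply: (cvg_comp _ _ yy0); exact: metric_coef_continuous.
Qed.

Let sqnorm_bound phi y w :
  chart_sqnorm phi y w <= (\sum_i \sum_j `|metric_coef phi i j y|) * `|w| ^+ 2.
Proof.
rewrite chart_sqnormE mulr_suml; apply: ler_sum => i _.
rewrite mulr_suml; apply: ler_sum => j _; apply: le_trans (ler_norm _) _.
rewrite !normrM mulrC ler_wpM2l// expr2 ler_pM//; exact: normr_coord.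
Qed.

Lemma chart_sqnorm_upper phi y0 : atlas phi -> chart_cod phi y0 ->
  exists2 C, 0 < C & \forall y \near y0, forall w, chart_sqnorm phi y w <= C ^+ 2 * `|w| ^+ 2.
Proof.
move=> aphi cy; pose S y := \sum_i \sum_j `|metric_coef phi i j y|.
have S0 y : 0 <= S y by apply: sumr_ge0 => i _; apply: sumr_ge0.
have Sc : S y @[y --> y0] --> S y0.
  by do 2!apply: (@cvg_bigsum _ _ (nbhs y0) (nbhs_filter y0)) => ?; apply: cvg_norm; exact: metric_coef_continuous.
(* Near y0 the sum S stays below S y0 + 1, which is at least 1 and so at most its square. *)
exists (S y0 + 1); first by rewrite ltr_wpDl.
have : \forall y \near y0, S y < S y0 + 1.
  by apply: (@cvgr_lt _ _ (nbhs y0) _ S (S y0) Sc); rewrite ltrDl.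
apply: filterS => y Sy w; apply: le_trans (sqnorm_bound _ _ _) _.
rewrite ler_wpM2r ?sqr_ge0//; apply: le_trans (ltW Sy) _.
by rewrite expr2 ler_peMr ?lerDr// addr_ge0.
Qed.

(** By homogeneity, the minimum e > 0 over the unit sphere bounds the form at y0 from below; near y0
    its coefficients change by less than e / 2 in total. *)
Lemma chart_sqnorm_lower phi y0 : atlas phi -> chart_cod phi y0 ->
  exists2 c, 0 < c & \forall y \near y0, forall w, c ^+ 2 * `|w| ^+ 2 <= chart_sqnorm phi y w.
Proof.
move=> aphi cy; pose K := [set w : 'rV[R]_n | `|w| = 1].
have cK : compact K.
  apply: bounded_closed_compact.
    by exists 1; split; [exact: num_real|move=> r r1 w /= ->; exact: ltW].
  rewrite (_ : K = (fun w : 'rV[R]_n => `|w|) @^-1` [set 1])//.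
  by apply: closed_comp => [w _|]; [exact: norm_continuous|exact: closed_eq].
have K0 : K !=set0.
  exists (`|'e_0 : 'rV[R]_n|^-1 *: 'e_0); rewrite /K /= normrZ normfV normr_id mulVf//.
  rewrite normr_eq0; apply/eqP => /rowP/(_ 0); rewrite !mxE !eqxx/=; exact/eqP/oner_neq0.
have cs : {within K, continuous (chart_sqnorm phi y0)}.
  apply: continuous_subspaceT => w.
  apply: (@cvg_chart_sqnorm phi _ (nbhs w) _ (cst y0) id y0 w) => //.
  exact: cvg_cst.
have [w0 /set_mem Kw0 w0min] := compact_EVT_min K0 cK cs.
set e := chart_sqnorm phi y0 w0 in w0min.
have e0 : 0 < e.
  apply: chart_sqnorm_gt0 => //; apply/eqP => w00; move: Kw0; rewrite /K /= w00 normr0.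
  by move/esym/eqP; rewrite oner_eq0.
pose D y := \sum_i \sum_j `|metric_coef phi i j y - metric_coef phi i j y0|.
have Dc : D y @[y --> y0] --> 0.
  have -> : 0 = \sum_(i < n) \sum_(j < n) (0 : R) by do 2!rewrite big1//.
  apply: (@cvg_bigsum _ _ (nbhs y0) (nbhs_filter y0)) => i.
  apply: (@cvg_bigsum _ _ (nbhs y0) (nbhs_filter y0)) => j.
  rewrite -[X in _ --> X](@normr0 _ R); apply: cvg_norm.
  rewrite -[X in _ --> X](subrr (metric_coef phi i j y0)).
  by apply: cvgB; [exact: metric_coef_continuous|exact: cvg_cst].
exists (Num.sqrt (e / 2)); first by rewrite sqrtr_gt0 divr_gt0.
have : \forall y \near y0, D y < e / 2 by apply: (@cvgr_lt _ _ (nbhs y0) _ D 0 Dc); rewrite divr_gt0.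
apply: filterS => y Dy w; rewrite sqr_sqrtr ?divr_ge0 ?(ltW e0)//.
have h1 : e * `|w| ^+ 2 <= chart_sqnorm phi y0 w.
  have [->|wn0] := eqVneq w 0; first by rewrite normr0 expr0n mulr0 chart_sqnorm_ge0.
  have nw : 0 < `|w| by rewrite normr_gt0.
  have := w0min (`|w|^-1 *: w); rewrite inE /K /= normrZ normfV normr_id mulVf ?gt_eqF//.
  by move=> /(_ erefl); rewrite chart_sqnormZ exprVn mulrC ler_pdivlMr// exprn_gt0.
have h2 : `|chart_sqnorm phi y w - chart_sqnorm phi y0 w| <= D y * `|w| ^+ 2.
  rewrite !chart_sqnormE -sumrB mulr_suml; apply: le_trans (ler_norm_sum _ _ _) _.
  apply: ler_sum => i _; rewrite -sumrB mulr_suml; apply: le_trans (ler_norm_sum _ _ _) _.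
  apply: ler_sum => j _; rewrite -mulrBr !normrM mulrC ler_wpM2l// expr2 ler_pM//; exact: normr_coord.
have h3 : D y * `|w| ^+ 2 <= e / 2 * `|w| ^+ 2 by rewrite ler_wpM2r ?sqr_ge0// ltW.
move: h2; rewrite ler_norml => /andP[h2 _].
exact: half_lower_bound h1 h3 h2.
Qed.
End metric.
End charts.

(** * The Riemannian distance *)

Section affine_curves.
Context {R : realType}.
Definition line (V : normedModType R) (y w : V) (t : R) : V := y + t *: w.
Lemma is_derive_line (V : normedModType R) (y w : V) (t : R) :
  is_derive t 1 (line y w) w.
Proof.
have H : h^-1 *: (line y w (h *: 1 + t) - line y w t) @[h --> 0^'] --> w.
  apply: cvg_near_cst; near=> h.
  have h0 : h != 0 by near: h; exact: nbhs_dnbhs_neq.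
  rewrite /line /= opprD addrACA subrr add0r -scalerBl [h *: 1]mulr1 addrK.
  by rewrite scalerA mulVf// scale1r.
apply: DeriveDef; first by apply/cvg_ex; exists w.
exact/cvg_lim.
Unshelve. all: by end_near. Qed.

Lemma differentiable_line (V : normedModType R) (y w : V) (t : R) :
  differentiable (line y w) t.
Proof. by apply/derivable1_diffP; case: (is_derive_line y w t). Qed.

Lemma diff_line (V : normedModType R) (y w : V) (t v : R) :
  'd (line y w) t v = v *: w.
Proof.
have dl := differentiable_line y w t.
have -> : v = v *: (1 : R^o) by rewrite [_ *: _]mulr1.
rewrite linearZ_LR -deriveE//; case: (is_derive_line y w t) => _ ->.
by rewrite [_ *: (1 : R^o)]mulr1.
Qed.

Lemma continuous_line (V : normedModType R) (y w : V) : continuous (line y w).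
Proof. by move=> t; exact/differentiable_continuous/differentiable_line. Qed.
End affine_curves.

Section segments.
Variables (R : realType) (m : nat) (M : manifold R m.+1).
Local Notation n := m.+1.
Implicit Types (phi psi : chart R n M) (x : M) (y w : 'rV[R]_n).
Lemma C1_curve_line phi y w (U : set R) : atlas phi ->
  (forall t, U t -> chart_cod phi (line y w t)) ->
  C1_curve_on U (chart_inv phi \o line y w).
Proof.
move=> aphi Uc; have cc t : U t -> {for t, continuous (chart_inv phi \o line y w)}.
  move=> Ut; apply: continuous_comp; first exact: continuous_line.
  exact: chart_inv_cont (Uc _ Ut).
split=> // psi apsi; pose T := psi \o chart_inv phi.
have dT t : U t -> chart_dom psi (chart_inv phi (line y w t)) -> differentiable T (line y w t).
  by move=> Ut dt; apply: transition_differentiable => //; exact: Uc.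
split.
  move=> t [Ut dt]; have dl := differentiable_line y w t.
  exact: (@differentiable_comp _ _ _ _ (line y w) T t dl (dT t Ut dt)).
move=> v t [Ut dt].
(* The derivative along the segment is a derivative of the transition map T in the fixed direction v
   w, which is continuous. *)
have E : \forall s \near t, 'D_(v *: w) T (line y w s) = 'D_v (psi \o (chart_inv phi \o line y w)) s.
  have near1 : \forall s \near t, chart_cod phi (line y w s) /\
      chart_dom psi (chart_inv phi (line y w s)).
    exact: (@continuous_line _ _ y w t _ (near_chart_inv_dom (Uc _ Ut) dt)).
  apply: filterS near1 => s [cs ds].
  have dTs : differentiable T (line y w s) by exact: transition_differentiable.
  have dl := differentiable_line y w s.
  have dc : differentiable (T \o line y w) s by exact: differentiable_comp.
  rewrite -[psi \o (_ \o _)]/(T \o line y w) deriveE// deriveE//.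
  by rewrite -(diff_compE _ dl dTs) diff_line.
have c2 : {for line y w t, continuous (fun z => 'D_(v *: w) T z)}.
  have [_ /(_ (v *: w)) H] := transition_C1 aphi apsi.
  apply: H; exists (chart_inv phi (line y w t)); last exact/chart_invK/Uc.
  by split=> //; apply: chart_inv_dom; exact: Uc.
have c3 : {for t, continuous ((fun z => 'D_(v *: w) T z) \o line y w)}.
  exact: (@continuous_comp _ _ _ (line y w) (fun z => 'D_(v *: w) T z) t (@continuous_line _ _ y w t) c2).
suff c4 : 'D_v (psi \o (chart_inv phi \o line y w)) s @[s --> t] -->
    'D_v (psi \o (chart_inv phi \o line y w)) t by exact: c4.
rewrite -(nbhs_singleton E); apply: cvg_trans c3.
by apply: near_eq_cvg; apply: filterS E => s /= ->.
Qed.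

Lemma chart_line_derive phi y w t : chart_cod phi (line y w t) ->
  derivable (phi \o (chart_inv phi \o line y w)) t 1 /\
  derive1 (phi \o (chart_inv phi \o line y w)) t = w.
Proof.
move=> ct.
have E : \forall s \near t, line y w s = (phi \o (chart_inv phi \o line y w)) s.
  have h : \forall s \near t, chart_cod phi (line y w s).
    exact: (@continuous_line _ _ y w t _ (near_chart_cod ct)).
  by apply: filterS h => s cs /=; rewrite chart_invK.
have [d1 d2] := near_eq_is_derive E (is_derive_line y w t).
by split; [exact: d1|rewrite derive1E; exact: d2].
Qed.

Section metric.
Variable g : forall x : M, tangent x -> tangent x -> R.
Hypothesis hg : riemannian_metric g.
Lemma gnorm_velocity_near (z1 z2 : R -> M) t : {near t, z1 =1 z2} ->
  gnorm g (velocity z1 t) = gnorm g (velocity z2 t).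
Proof.
move=> E; have e := nbhs_singleton E.
rewrite /gnorm /velocity e.
suff -> : derive1 (chart_at (z2 t) \o z1) t = derive1 (chart_at (z2 t) \o z2) t by [].
by rewrite !derive1E; apply: near_eq_derive; apply: filterS E => s /= ->.
Qed.

Lemma gnorm_velocity_line phi y w t : atlas phi -> chart_cod phi (line y w t) ->
  gnorm g (velocity (chart_inv phi \o line y w) t) =
  Num.sqrt (chart_sqnorm g phi (line y w t) w).
Proof.
move=> aphi ct; have [d1 d2] := chart_line_derive ct.
have cc : {for t, continuous (chart_inv phi \o line y w)}.
  apply: continuous_comp; first exact: continuous_line.
  exact: chart_inv_cont.
have dd : chart_dom phi ((chart_inv phi \o line y w) t) by exact: chart_inv_dom.
rewrite /gnorm (sqnorm_velocity g aphi dd cc d1) d2.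
by have -> : phi ((chart_inv phi \o line y w) t) = line y w t by rewrite /= chart_invK.
Qed.
End metric.
End segments.

Section dist_extend.
Variables (R : realType) (m : nat) (M : manifold R m.+1).
Local Notation n := m.+1.
Notation mu := (@lebesgue_measure R).
Implicit Types (phi psi : chart R n M) (x : M) (y w : 'rV[R]_n).
Variable g : forall x : M, tangent x -> tangent x -> R.
Hypothesis hg : riemannian_metric g.
Lemma gnorm_ge0 x (v : tangent x) : 0 <= gnorm g v.
Proof. exact: sqrtr_ge0. Qed.

Lemma curve_length_ge0 a b (z : R -> M) : (0 <= curve_length g a b z)%E.
Proof. by apply: integral_ge0 => t _; rewrite lee_fin gnorm_ge0. Qed.

Lemma dist_ge0 x x' : (0 <= dist g x x')%E.
Proof.
by apply: le_ereal_inf_tmp => _ [a [b [z [_ _ _ ->]]]]; exact: curve_length_ge0.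
Qed.

Lemma dist_xx x : dist g x x = 0%E.
Proof.
apply/eqP; rewrite eq_le dist_ge0 andbT; apply: ereal_inf_lbound.
exists 0, 0, (fun _ => x); split=> //.
  by exists [::]; split => //; split.
by rewrite /curve_length set_itv1 integral_set1.
Qed.

(** For S >= 0 this bounds by S the speed, hence the length, of the straight chart segment run in
    unit time. *)
Definition segment_bound phi y1 y2 (S : R) := forall t, 0 <= t <= 1 ->
  chart_cod phi (line y1 (y2 - y1) t) /\
  chart_sqnorm g phi (line y1 (y2 - y1) t) (y2 - y1) <= S ^+ 2.
(* This is the only concatenation of curves that is needed: it says that
   [dist g x] is infinitesimally nonexpansive, and the triangle inequality
   and the symmetry of the distance follow by integration along curves. *)
Lemma dist_extend phi x y1 y2 S : atlas phi -> 0 <= S -> segment_bound phi y1 y2 S ->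
  (dist g x (chart_inv phi y2) <= dist g x (chart_inv phi y1) + S%:E)%E.
Proof.
move=> aphi S0 Sb; rewrite -leeBlDr//; apply: le_ereal_inf_tmp => _ [a [b [z [pz za zb ->]]]].
(* The time shift by b lets the segment start at the time b at which z ends. *)
rewrite leeBlDr//; pose w := y2 - y1; pose yb := y1 - b *: w.
have lineE t : line yb w t = line y1 w (t - b).
  by rewrite /line /yb scalerBl -addrA (addrC (- _)).
have inb t : t \in `[b, b + 1] -> 0 <= t - b <= 1.
  by rewrite in_itv/= => /andP[h1 h2]; rewrite subr_ge0 h1 lerBlDl.
pose ze := chart_inv phi \o line yb w.
pose z' t := if t <= b then z t else ze t.
have zeb : ze b = z b.
  by rewrite /ze /= lineE subrr /line scale0r addr0 zb.
have [s [ps Hs]] := pz; have ab := itv_partition_le ps.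
have sizes i : (i < size s)%N -> nth b (a :: s) i.+1 <= b.
  by move=> si; apply: (itv_partition_nth_le _ ps); rewrite ltnS.
apply: (@le_trans _ _ (curve_length g a (b + 1) z')).
  apply: ereal_inf_lbound; exists a, (b + 1), z'; split => //.
  - exists (rcons s (b + 1)); split.
      have [ps1 /eqP ps2] := ps.
      by split; rewrite ?last_rcons// rcons_path ps1 ps2 /= ltrDl.
    move=> i; rewrite size_rcons ltnS leq_eqVlt => /predU1P[->|si].
      rewrite -[a :: rcons _ _]/(rcons (a :: s) (b + 1)) !nth_rcons /= ltnn eqxx ltnS leqnn.
      have -> : nth (b + 1) (a :: s) (size s) = b.
        by rewrite -last_nth; case: ps => _ /eqP.
      pose U : set R := [set t | chart_cod phi (line yb w t)].
      exists U, ze; split.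
      + rewrite openE => t /= ct; exact: (@continuous_line _ _ yb w t _ (near_chart_cod ct)).
      + by move=> t /inb /Sb[]; rewrite -lineE.
      + exact: C1_curve_line.
      + move=> t; rewrite in_itv/= => /andP[bt _]; rewrite /z'; case: ifPn => // tb.
        have -> : t = b by apply/eqP; rewrite eq_le tb bt.
        exact: zeb.
    have [U [eta [oU IU CU eU]]] := Hs i si.
    have nthE j : (j <= size s)%N -> nth (b + 1) (a :: rcons s (b + 1)) j = nth b (a :: s) j.
      move=> js; rewrite -[a :: rcons _ _]/(rcons (a :: s) (b + 1)) nth_rcons /= ltnS js.
      by apply: set_nth_default; rewrite /= ltnS.
    rewrite (nthE i (ltnW si)) (nthE i.+1 si).
    exists U, eta; split=> // t tI; rewrite eU// /z'.
    case: ifPn => //; move: tI; rewrite in_itv /= => /andP[_ tn].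
    by rewrite (le_trans tn)//; exact: (sizes i si).
  - by rewrite /z' ab.
  - rewrite /z' leNgt ltrDl ltr01 /= /ze /= lineE addrC addKr /line scale1r /w.
    by rewrite addrCA subrr addr0.
rewrite /curve_length.
have -> : `[a, (b + 1)]%classic = `[a, b]%classic `|` `]b, (b + 1)]%classic :> set R.
  by rewrite -itv_bndbnd_setU// bnd_simp// lerDl.
apply: le_trans; first apply: lower_integral_setU_le => //.
- apply/disj_setPS => t [] /=; rewrite !in_itv/= => /andP[_ tb] /andP[bt _].
  by move: (lt_le_trans bt tb); rewrite ltxx.
- by move=> t _; rewrite lee_fin gnorm_ge0.
apply: leeD.
  apply: ae_le_lower_integral => //.
  (* At the junction b the velocity of z' is not controlled; at earlier times z' agrees with z in a
     neighbourhood. *)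
  exists [set b]; split => //; first exact: lebesgue_measure_set1.
  move=> t /= h; apply: contrapT => tb; apply: h; rewrite in_itv /= => /andP[_ tleb].
  have tb' : t < b by rewrite lt_neqAle tleb andbT; apply/eqP.
  rewrite lee_fin (@gnorm_velocity_near _ _ _ _ z' z)//.
  by apply: filterS (lt_nbhsl tb') => u ub; rewrite /z' ltW.
apply: (@le_trans _ _ (\int[mu]_(t in `]b, (b + 1)%R]) S%:E)%E).
  apply: ae_le_lower_integral => //.
  exists [set b + 1]; split => //; first exact: lebesgue_measure_set1.
  move=> t /= h; apply: contrapT => tb; apply: h; rewrite in_itv /= => /andP[bt tleb].
  rewrite lee_fin (@gnorm_velocity_near _ _ _ _ z' ze); last first.
    by apply: filterS (lt_nbhsr bt) => u bu; rewrite /z' leNgt bu.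
  have [|ct St] := Sb (t - b); first by apply: inb; rewrite in_itv/= ltW.
  rewrite -lineE in ct St.
  by rewrite (gnorm_velocity_line _ aphi ct) -(ger0_norm S0) -sqrtr_sqr ler_sqrt// sqr_ge0.
have mu1 : mu `]b, (b + 1)]%classic = 1%E.
  by rewrite lebesgue_measure_itv /= lte_fin ltrDl ltr01 -EFinB addrAC subrr add0r.
rewrite integral_cst// -[leRHS]mule1 le_eqVlt; apply/orP; left; apply/eqP.
by congr (_ * _)%E; exact: mu1.
Qed.
End dist_extend.

Lemma derive_quotient_cvg (R : realType) (V : normedModType R) (f : R -> V) (t : R) :
  derivable f t 1 -> h^-1 *: (f (t + h) - f t) @[h --> 0^'] --> derive1 f t.
Proof.
move=> df; have := df; rewrite derive1E /derive /derivable => /cvg_toP/(_ erefl).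
apply: cvg_trans; apply: near_eq_cvg; near=> h.
by rewrite /= [h *: 1]mulr1 (addrC h t).
Unshelve. all: by end_near. Qed.

(** * Nonexpansive functions along curves *)

Section curves.
Variables (R : realType) (m : nat) (M : manifold R m.+1).
Local Notation n := m.+1.
Notation mu := (@lebesgue_measure R).
Implicit Types (phi psi : chart R n M) (x p : M) (y w : 'rV[R]_n) (F : M -> R).
Variable g : forall x : M, tangent x -> tangent x -> R.
Hypothesis hg : riemannian_metric g.
(* Infinitesimal form of "F is 1-Lipschitz for the distance of g near p". *)
Definition nonexpansive_at F p := exists phi r,
  [/\ atlas phi, chart_dom phi p, 0 < r,
      forall y, `|y - phi p| < r -> chart_cod phi y
    & forall y1 y2 S, `|y1 - phi p| < r -> `|y2 - phi p| < r -> 0 <= S ->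
        segment_bound g phi y1 y2 S -> F (chart_inv phi y2) - F (chart_inv phi y1) <= S].
Lemma line_ball (c y1 y2 : 'rV[R]_n) (r t : R) : `|y1 - c| < r -> `|y2 - c| < r ->
  0 <= t <= 1 -> `|line y1 (y2 - y1) t - c| < r.
Proof.
move=> h1 h2 /andP[t0 t1].
have -> : line y1 (y2 - y1) t - c = (1 - t) *: (y1 - c) + t *: (y2 - c).
  by rewrite /line; apply/rowP => i; rewrite !mxE; ring.
have [->|t0'] := eqVneq t 0; first by rewrite subr0 scale1r scale0r addr0.
have tp : 0 < t by rewrite lt_neqAle eq_sym t0' t0.
apply: le_lt_trans (ler_normD _ _) _; rewrite !normrZ (ger0_norm t0) ger0_norm ?subr_ge0//.
have -> : r = (1 - t) * r + t * r by ring.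
by rewrite ler_ltD// ?ler_wpM2l ?subr_ge0 ?(ltW h1)// ltr_pM2l.
Qed.

Lemma segment_bound_sym phi y1 y2 S : segment_bound g phi y1 y2 S ->
  segment_bound g phi y2 y1 S.
Proof.
move=> H t /andP[t0 t1].
have e : line y2 (y1 - y2) t = line y1 (y2 - y1) (1 - t).
  rewrite /line scalerBl scale1r -(opprB y2 y1) scalerN.
  by rewrite [RHS]addrA addrCA subrr addr0.
have [|c1 c2] := H (1 - t); first by rewrite subr_ge0 t1 lerBlDr lerDl.
rewrite e; split=> //.
by rewrite -(opprB y2 y1) -(scaleN1r (y2 - y1)) (chart_sqnormZ hg) sqrrN expr1n mul1r.
Qed.

(** The one-sided condition is applied to the reversed segment as well. *)
Lemma nonexpansive_dist_chart F phi p r y1 y2 S :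
  (forall y1 y2 S, `|y1 - phi p| < r -> `|y2 - phi p| < r -> 0 <= S ->
     segment_bound g phi y1 y2 S -> F (chart_inv phi y2) - F (chart_inv phi y1) <= S) ->
  `|y1 - phi p| < r -> `|y2 - phi p| < r -> 0 <= S -> segment_bound g phi y1 y2 S ->
  `|F (chart_inv phi y2) - F (chart_inv phi y1)| <= S.
Proof.
move=> H h1 h2 S0 Sb; rewrite ler_norml; apply/andP; split; last exact: H.
by rewrite lerNl opprB; apply: H => //; exact: segment_bound_sym.
Qed.

(** Near p the chart segment from y1 to y2 has speed at most C |y2 - y1|, with C from
    [chart_sqnorm_upper]. This is what makes F o z absolutely continuous. *)
Lemma nonexpansive_lipschitz F phi p r : atlas phi -> chart_dom phi p -> 0 < r ->
  (forall y, `|y - phi p| < r -> chart_cod phi y) ->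
  (forall y1 y2 S, `|y1 - phi p| < r -> `|y2 - phi p| < r -> 0 <= S ->
     segment_bound g phi y1 y2 S -> F (chart_inv phi y2) - F (chart_inv phi y1) <= S) ->
  exists C r', [/\ 0 < C, 0 < r', r' <= r &
    forall y1 y2, `|y1 - phi p| < r' -> `|y2 - phi p| < r' ->
     `|F (chart_inv phi y2) - F (chart_inv phi y1)| <= C * `|y2 - y1|].
Proof.
move=> aphi dp r0 rc H.
have [C C0 /nbhs_ballP[r1 /= r10 Cb]] := chart_sqnorm_upper hg aphi (chart_cod_map dp).
exists C, (Num.min r r1); split=> //; first by rewrite lt_min r0.
  by rewrite ge_min lexx.
move=> y1 y2; rewrite !lt_min => /andP[h1 h1'] /andP[h2 h2'].
apply: (nonexpansive_dist_chart H) => //; first by rewrite mulr_ge0// ltW.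
move=> t t01; split; first by apply: rc; exact: line_ball.
rewrite exprMn; apply: Cb; rewrite -ball_normE /= distrC; exact: line_ball.
Qed.

(** Between z t and z (t + h) the function F changes by at most the maximal speed of the chart
    segment joining them: |h| times the norm of a difference quotient at base points near z t. Joint
    continuity of the form gives the norm of the velocity in the limit. *)
Lemma nonexpansive_derivative F phi p r (z : R -> M) t : atlas phi ->
  (forall y, `|y - phi p| < r -> chart_cod phi y) ->
  (forall y1 y2 S, `|y1 - phi p| < r -> `|y2 - phi p| < r -> 0 <= S ->
     segment_bound g phi y1 y2 S -> F (chart_inv phi y2) - F (chart_inv phi y1) <= S) ->
  {for t, continuous z} -> chart_dom phi (z t) -> `|phi (z t) - phi p| < r ->
  derivable (phi \o z) t 1 -> derivable (F \o z) t 1 ->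
  `|derive1 (F \o z) t| <= gnorm g (velocity z t).
Proof.
move=> aphi rc H cz dz zr dphi dF; set y := phi (z t) in zr *.
rewrite /gnorm (sqnorm_velocity g aphi dz cz dphi) -/y.
set v := derive1 (phi \o z) t; set G := chart_sqnorm g phi y v.
have G0 : 0 <= G by exact: chart_sqnorm_ge0.
suff D2 : `|derive1 (F \o z) t| ^+ 2 <= G.
  by rewrite -[leLHS](ger0_norm (normr_ge0 _)) -sqrtr_sqr ler_sqrt.
apply/ler_addgt0Pr => e e0.
have Ge0 : 0 <= G + e by rewrite addr_ge0// ltW.
suff DG : `|derive1 (F \o z) t| <= Num.sqrt (G + e).
  by rewrite -[leRHS](sqr_sqrtr Ge0) ler_pXn2r// nnegrE// sqrtr_ge0.
have cy : chart_cod phi y by exact: chart_cod_map.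
(* A is a neighbourhood of base points and B one of difference quotients on which the form stays
   below G + e. *)
have [[A B] [nA nB] AB] : filter_prod (nbhs y) (nbhs v)
    [set yw | chart_sqnorm g phi yw.1 yw.2 < G + e].
  have cs : chart_sqnorm g phi yw.1 yw.2 @[yw --> filter_prod (nbhs y) (nbhs v)] --> G.
    exact (@cvg_chart_sqnorm R m M g hg phi _ (filter_prod (nbhs y) (nbhs v)) _ fst snd y v aphi cy cvg_fst cvg_snd).
  by apply: (@cvgr_lt _ _ (filter_prod (nbhs y) (nbhs v)) _ _ G cs); rewrite ltrDl.
have /nbhs_ballP[del /= del0 delA] := nA.
have cq := derive_quotient_cvg dphi.
have nearB := cq _ nB.
have cyz : {for t, continuous (phi \o z)} by exact: chart_continuous_comp.
(* Within [eta] of y, the segment stays in A and its end point in the ball of radius r where F is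
   controlled. *)
pose eta := Num.min del (r - `|y - phi p|).
have eta0 : 0 < eta by rewrite lt_min del0 subr_gt0.
have shift_near (P : set R) : nbhs t P -> \forall h \near 0^', P (t + h).
  move=> /nbhs_ballP[d /= d0 dP]; apply/nbhs_dnbhs/nbhs_ballP; exists d => //= h.
  rewrite /ball /= sub0r normrN => hd; apply: dP; rewrite /ball/= opprD addrA subrr sub0r.
  by rewrite normrN.
have near1 : \forall h \near 0^', `|(phi \o z) (t + h) - y| < eta.
  apply: (shift_near (fun s => `|(phi \o z) s - y| < eta)).
  have /cvgrPdist_lt /(_ _ eta0) := cyz.
  by apply: filterS => s; rewrite distrC.
have near2 : \forall h \near 0^', chart_dom phi (z (t + h)).
  by apply: (shift_near (fun s => chart_dom phi (z s))); exact: cz (near_chart_dom dz).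
have near3 : \forall h \near 0^', `|h^-1 *: ((F \o z) (t + h) - (F \o z) t)| <= Num.sqrt (G + e).
  near=> h.
  have h0 : h != 0 by near: h; exact: nbhs_dnbhs_neq.
  have dh : chart_dom phi (z (t + h)) by near: h.
  have weta : `|(phi \o z) (t + h) - y| < eta by near: h.
  have Bh : B (h^-1 *: ((phi \o z) (t + h) - (phi \o z) t)) by near: h; exact: nearB.
  set y' := (phi \o z) (t + h) in weta Bh.
  have y'r : `|y' - phi p| < r.
    have -> : y' - phi p = (y' - y) + (y - phi p) by rewrite addrA subrK.
    apply: le_lt_trans (ler_normD _ _) _.
    by move: weta; rewrite lt_min => /andP[_]; rewrite ltrBrDr.
  have Fe s : chart_dom phi (z s) -> F (chart_inv phi (phi (z s))) = (F \o z) s.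
    by move=> ds; rewrite chart_mapK.
  have key : `|(F \o z) (t + h) - (F \o z) t| <= `|h| * Num.sqrt (G + e).
    rewrite -!Fe//; apply: (nonexpansive_dist_chart H) => //.
    move=> s s01; split; first by apply: rc; exact: line_ball.
    have -> : phi (z (t + h)) - phi (z t) = h *: (h^-1 *: (y' - y)).
      by rewrite scalerA mulfV// scale1r.
    rewrite (chart_sqnormZ hg) exprMn sqr_sqrtr// real_normK ?num_real//.
    rewrite ler_wpM2l ?sqr_ge0//; apply/ltW.
    apply: (AB (_, _)); split=> //=; apply: delA; rewrite -ball_normE /=.
    rewrite scalerA mulfV// scale1r.
    rewrite /line opprD addrA subrr sub0r normrN normrZ.
    have [s0 s1] := andP s01; rewrite ger0_norm//.
    apply: (@le_lt_trans _ _ `|y' - y|); first by rewrite ler_piMl.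
    by move: weta; rewrite lt_min => /andP[].
  rewrite normrZ normfV mulrC ler_pdivrMr ?normr_gt0// mulrC; exact: key.
have := derive_quotient_cvg dF => /cvg_norm cF.
exact: (cvgr_to_le cF near3).
Unshelve. all: by end_near. Qed.
End curves.

Section row_derivatives.
Context {R : realType}.
Lemma row_norm_le (k : nat) (w : 'rV[R]_k) B : 0 <= B -> (forall i, `|w 0 i| <= B) -> `|w| <= B.
Proof.
move=> B0 wB; rewrite -[leLHS]/(mx_norm w) mx_normrE; apply/bigmax_leP; split=> //= -[i j] _.
by rewrite ord1.
Qed.

Lemma is_derive_coord (k : nat) (f : R -> 'rV[R]_k) t i : derivable f t 1 ->
  is_derive t 1 (fun u => f u 0 i) (('D_1 f t) 0 i).
Proof.
move=> df; have H : h^-1 *: (f (h *: 1 + t) 0 i - f t 0 i) @[h --> 0^'] --> ('D_1 f t) 0 i.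
  have c : h^-1 *: (f (h *: 1 + t) - f t) @[h --> 0^'] --> 'D_1 f t.
    by have := df; rewrite /derive /derivable => /cvg_toP/(_ erefl).
  have c' : (h^-1 *: (f (h *: 1 + t) - f t)) 0 i @[h --> 0^'] --> ('D_1 f t) 0 i.
    exact: (cvg_comp (fun h => h^-1 *: (f (h *: 1 + t) - f t)) (fun N : 'rV[R]_k => N 0 i) c (@coord_continuous _ _ _ 0 i ('D_1 f t))).
  by apply: cvg_trans c'; apply: near_eq_cvg; near=> h; rewrite !mxE.
apply: DeriveDef; first by apply/cvg_ex; exists (('D_1 f t) 0 i).
exact/cvg_lim.
Unshelve. all: by end_near. Qed.

(** The norm of a row is the maximum over its components, so the scalar mean value theorem applies
    to each of them. *)
Lemma row_mean_value (k : nat) (f : R -> 'rV[R]_k) a b B : a <= b -> 0 <= B ->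
  (forall t, a <= t <= b -> derivable f t 1 /\ `|'D_1 f t| <= B) ->
  `|f b - f a| <= B * (b - a).
Proof.
move=> ab B0 df; apply: row_norm_le => [|i]; first by rewrite mulr_ge0// subr_ge0.
pose fi u := f u 0 i; have dfi t : a <= t <= b -> is_derive t 1 fi (('D_1 f t) 0 i).
  by move=> /df[dt _]; exact: is_derive_coord.
have -> : (f b - f a) 0 i = fi b - fi a by rewrite !mxE.
have [c cab ->] : exists2 c, c \in `[a, b] & fi b - fi a = (('D_1 f c) 0 i) * (b - a).
  apply: (@MVT_segment _ fi (fun t => ('D_1 f t) 0 i)) => //.
    by move=> t; rewrite in_itv/= => /andP[h1 h2]; apply: dfi; rewrite !ltW.
  apply: continuous_in_subspaceT => t; rewrite inE/= in_itv/= => /dfi[h _].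
  by apply: differentiable_continuous; exact/derivable1_diffP.
rewrite normrM (ger0_norm (_ : 0 <= b - a)) ?subr_ge0// ler_wpM2r ?subr_ge0//.
by have [|_] := df c; [move: cab; rewrite in_itv|apply: le_trans; exact: normr_coord].
Qed.
End row_derivatives.

Section curve_bound.
Variables (R : realType) (m : nat) (M : manifold R m.+1).
Local Notation n := m.+1.
Notation mu := (@lebesgue_measure R).
Implicit Types (phi psi : chart R n M) (x p : M) (y w : 'rV[R]_n) (F : M -> R).
Variable g : forall x : M, tangent x -> tangent x -> R.
Hypothesis hg : riemannian_metric g.
(** [absolutely_continuous_curve] on any segment, in order to cover the pieces of piecewise C^1
    curves too. *)
Definition ac_curve_on (a b : R) (z : R -> M) :=
  {within `[a, b], continuous z} /\
  forall phi, atlas phi -> forall s t, a <= s -> s <= t -> t <= b ->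
    (forall u, u \in `[s, t] -> chart_dom phi (z u)) ->
    absolutely_continuous_on s t (phi \o z).
(** The derivative in a chart has a maximal norm B on [s, t], so the curve is Lipschitz there; B + 1
    is used in order to divide. *)
Lemma C1_curve_ac (U : set R) (z : R -> M) a b : open U -> [set` `[a, b]] `<=` U ->
  C1_curve_on U z -> ac_curve_on a b z.
Proof.
move=> oU abU [cz C1z]; split.
  by apply: continuous_in_subspaceT => t /set_mem /abU; exact: cz.
move=> phi aphi s t as_ st tb dst; have [dphi cphi] := C1z phi aphi.
have inU u : u \in `[s, t] -> (U `&` z @^-1` chart_dom phi) u.
  move=> ust; split; last exact: dst.
  by apply: abU => /=; move: ust; rewrite !in_itv/= => /andP[h1 h2]; rewrite (le_trans as_ h1) (le_trans h2 tb).
pose f := phi \o z.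
have cN : {within `[s, t], continuous (fun u => `|'D_1 f u|)}.
  apply: continuous_in_subspaceT => u /set_mem /inU /(cphi 1) h.
  by apply: cvg_norm; exact: h.
have [u0 _ HB] : exists2 c, c \in `[s, t] & forall u, u \in `[s, t] -> `|'D_1 f u| <= `|'D_1 f c|.
  exact: EVT_max.
pose B := `|'D_1 f u0|; have B0 : 0 <= B by exact: normr_ge0.
have B10 : 0 < B + 1 by rewrite ltr_wpDl.
have lip u v : s <= u -> u <= v -> v <= t -> `|f v - f u| <= B * (v - u).
  move=> su uv vt; apply: (@row_mean_value R n f u v B uv B0) => w /andP[uw wv].
  have ws : w \in `[s, t] by rewrite in_itv/= (le_trans su uw) (le_trans wv vt).
  split; last exact: HB.
  exact/derivable1_diffP/dphi/inU.
move=> e e0; exists (e / (B + 1)); first by rewrite divr_gt0.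
move=> k a' b' ab' _ len.
apply: (@le_lt_trans _ _ (\sum_(i < k) (B + 1) * (b' i - a' i))).
  apply: ler_sum => i _; have [h1 [h2 h3]] := ab' i.
  by apply: le_trans (lip _ _ h1 h2 h3) _; rewrite ler_wpM2r ?subr_ge0// lerDl.
by rewrite -mulr_sumr mulrC -ltr_pdivlMr.
Qed.

(** The claim is local and is glued by [itv_local_global]. In a chart around z x0, F o z and the
    coordinates of z are absolutely continuous, so both are derivable almost everywhere, and there
    [nonexpansive_derivative] applies. *)
Lemma curve_bound F a b (z : R -> M) : (forall p, nonexpansive_at g F p) -> a <= b ->
  ac_curve_on a b z ->
  ae_derivative_bound a b (F \o z) (fun t => gnorm g (velocity z t)).
Proof.
move=> Fne ab [cz acz].
apply: (@itv_local_global R a b (fun s t =>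
  ae_derivative_bound s t (F \o z) (fun u => gnorm g (velocity z u))) ab).
  move=> x y w ax xy yw wb; exact: ae_derivative_bound_glue.
move=> x0 x0ab; have [phi [r [aphi dp r0 rc HF]]] := Fne (z x0).
have [C [r' [C0 r'0 r'r FC]]] := nonexpansive_lipschitz hg aphi dp r0 rc HF.
pose V q := chart_dom phi q /\ `|phi q - phi (z x0)| < r'.
have nV : nbhs (z x0) V.
  apply: filterI; first exact: near_chart_dom.
  have := chart_map_cont dp => /cvgrPdist_lt /(_ _ r'0).
  by apply: filterS => q; rewrite distrC.
have [e e0 Ve] : exists2 e, 0 < e & forall u, a <= u <= b -> `|u - x0| < e -> V (z u).
  have /(subspace_continuousP _ z) /(_ x0) := cz.
  rewrite /= in_itv /= => /(_ x0ab) /(_ _ nV) /nbhs_ballP[e /= e0 He].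
  exists e => // u uab ue; apply: He; rewrite /= ?in_itv//.
  by rewrite /ball /= distrC.
exists e => // s t as_ st tb xs tx.
have Vst u : u \in `[s, t] -> V (z u).
  rewrite in_itv/= => /andP[su ut]; apply: Ve.
    by rewrite (le_trans as_ su) (le_trans ut tb).
  by rewrite ltr_distl; apply/andP; split; [exact: lt_le_trans su|exact: le_lt_trans tx].
have acphi := acz phi aphi s t as_ st tb (fun u ust => (Vst u ust).1).
have Fe u : chart_dom phi (z u) -> F (chart_inv phi (phi (z u))) = F (z u).
  by move=> du; rewrite chart_mapK.
have acF : ac_seq s t (F \o z).
  apply: (absolutely_continuous_ac_seq acphi C0) => u v us vs.
  have [du hu] : V (z u) by apply: Vst; rewrite in_itv.
  have [dv hv] : V (z v) by apply: Vst; rewrite in_itv.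
  by rewrite /= -(Fe u)// -(Fe v)//; exact: FC.
have accoord (i : 'I_n) : ac_seq s t (fun u => phi (z u) 0 i).
  apply: (absolutely_continuous_ac_seq acphi ltr01) => u v us vs.
  by rewrite mul1r; have := @normr_coord R n (phi (z v) - phi (z u)) i; rewrite !mxE.
have aeder : {ae mu, forall u, s < u < t -> derivable (phi \o z) u 1}.
  have H : {ae mu, forall u, forall i : 'I_n, s < u < t -> derivable (fun u => phi (z u) 0 i) u 1}.
    apply: (@filter_forall _ 'I_n
      (fun i u => s < u < t -> derivable (fun u => phi (z u) 0 i) u 1)
      (almost_everywhere mu) (ae_filter_ringOfSetsType mu)) => i.
    have [h [ih hE]] := ac_integral st (accoord i).
    have := ac_ae_derive ih hE.
    apply: filterS; first exact: (ae_filter_ringOfSetsType mu).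
    by move=> u H ust; have [] := H ust.
  move: H; apply: filterS; first exact: (ae_filter_ringOfSetsType mu).
  by move=> u H ust; apply/derivable_mxP => i j; rewrite ord1; exact: H.
apply: ae_derivative_bound_local => //.
move: aeder; apply: filterS; first exact: (ae_filter_ringOfSetsType mu).
move=> u H ust dF; have [su ut] := andP ust.
have [du hu] : V (z u) by apply: Vst; rewrite in_itv/= !ltW.
have cu : {for u, continuous z}.
  have /(subspace_continuousP _ z) /(_ u) := cz.
  rewrite /= in_itv /= (le_trans as_ (ltW su)) (le_trans (ltW ut) tb) => /(_ isT).
  have ni : \forall v \near u, v \in `]a, b[.
    by apply: near_in_itvoo; rewrite in_itv/= (le_lt_trans as_ su) (lt_le_trans ut tb).
  rewrite within_interior//; apply: filterS ni => v /=.
  by rewrite !in_itv/= => /andP[h1 h2]; rewrite !ltW.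
apply: (nonexpansive_derivative hg aphi rc HF) => //.
  exact: lt_le_trans hu r'r.
exact: H.
Qed.
End curve_bound.

(** * Metric properties of the distance *)

Section distance.
Variables (R : realType) (m : nat) (M : manifold R m.+1).
Local Notation n := m.+1.
Notation mu := (@lebesgue_measure R).
Implicit Types (phi psi : chart R n M) (x p : M) (y w : 'rV[R]_n) (F : M -> R).
Variable g : forall x : M, tangent x -> tangent x -> R.
Hypothesis hg : riemannian_metric g.
Lemma piecewise_C1_bound F a b (z : R -> M) : (forall p, nonexpansive_at g F p) ->
  piecewise_C1 a b z ->
  ae_derivative_bound a b (F \o z) (fun t => gnorm g (velocity z t)).
Proof.
move=> Fne [s [ps Hs]]; elim: s a ps Hs => [|x s ih] a ps Hs.
  rewrite (itv_partition_nil ps).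
  exists (fun=> 0); split.
  - exact: integrable0.
  - move=> u v bu uv vb; have -> : u = v by apply/eqP; rewrite eq_le uv (le_trans vb).
    by rewrite subrr set_itvoc0 Rintegral_set0.
  - by apply: aeW => t _; rewrite normr0 sqrtr_ge0.
have ps' := itv_partition_cons ps.
have ax : a <= x by case: ps => /= /andP[/ltW].
apply: (@ae_derivative_bound_glue _ _ x) => //; first exact: itv_partition_le ps'.
  have [//|U [eta [oU IU CU eU]]] := Hs 0%N.
  have {}eU t : a <= t <= x -> eta t = z t by move=> tax; apply: eU; rewrite /= in_itv.
  have [h [ih' hE hb]] := curve_bound hg Fne ax (C1_curve_ac oU IU CU).
  exists h; split; first exact: ih'.
    move=> u v au uv vx; rewrite -hE//.
    have -> : (F \o z) u = (F \o eta) u.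
      by rewrite /= eU// au (le_trans uv vx).
    by rewrite /= !eU// ?vx ?(le_trans au uv) ?au ?(le_trans uv vx).
  move: hb; apply: filterS; first exact: (ae_filter_ringOfSetsType mu).
  move=> t H tax; apply: le_trans (H tax) _.
  rewrite (@gnorm_velocity_near _ _ _ _ z eta)//.
  have ni : \forall v \near t, v \in `]a, x[ by apply: near_in_itvoo; rewrite in_itv.
  apply: filterS ni => v; rewrite in_itv/= => /andP[h1 h2]; rewrite eU//.
  by rewrite !ltW.
by apply: ih => // i si; exact: (Hs i.+1).
Qed.

(** From infinitesimal to global: along every competing curve the increment of F is at most the
    integral of the speed. *)
Lemma nonexpansive_le_dist F x x' : (forall p, nonexpansive_at g F p) ->
  (`|F x' - F x|%:E <= dist g x x')%E.
Proof.
move=> Fne; apply: le_ereal_inf_tmp => _ [a [b [z [pz <- <- ->]]]].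
apply: (@ae_derivative_bound_le_integral _ a b (F \o z)
  (fun t => gnorm g (velocity z t))); first by case: pz => s [/itv_partition_le].
exact: piecewise_C1_bound.
Qed.

Lemma chart_ball p : exists phi r, [/\ atlas phi, chart_dom phi p, 0 < r &
  forall y, `|y - phi p| < r -> chart_cod phi y].
Proof.
have ca := chart_at_atlas p; have cd := chart_at_dom p.
have /nbhs_ballP[r /= r0 rc] := near_chart_cod (chart_cod_map cd).
exists (chart_at p), r; split=> // y yr; apply: rc.
by rewrite -ball_normE /= distrC.
Qed.

(** A chart segment between p and q is appended in either direction. The distances may still be
    infinite and are not yet known to be symmetric, whence the two additive inequalities. *)
Lemma near_dist_extend p : exists C, 0 <= C /\
  forall x, \forall q \near p, (dist g x q <= dist g x p + C%:E)%E /\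
                               (dist g x p <= dist g x q + C%:E)%E.
Proof.
have [phi [r [aphi dp r0 rc]]] := chart_ball p.
have [C C0 /nbhs_ballP[r1 /= r10 Cb]] := chart_sqnorm_upper hg aphi (chart_cod_map dp).
pose r' := Num.min r r1; have r'0 : 0 < r' by rewrite lt_min r0.
exists (C * r'); split; first by rewrite mulr_ge0// ltW.
move=> x.
have sb y : `|y - phi p| < r' -> segment_bound g phi (phi p) y (C * r').
  move=> yr t t01.
  have pr0 : `|phi p - phi p| < r' by rewrite subrr normr0.
  have /andP[l1 l2] : (`|line (phi p) (y - phi p) t - phi p| < r) && (`|line (phi p) (y - phi p) t - phi p| < r1).
    by rewrite -lt_min; exact: line_ball.
  split; first exact: rc.
  apply: le_trans; first by apply: Cb; rewrite -ball_normE /= distrC.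
  rewrite -exprMn ler_pXn2r ?nnegrE ?mulr_ge0 ?(ltW C0) ?(ltW r'0)//.
  by rewrite ler_wpM2l ?(ltW C0) ?(ltW yr).
have n1 : \forall q \near p, `|phi q - phi p| < r'.
  have := chart_map_cont dp => /cvgrPdist_lt /(_ _ r'0).
  by apply: filterS => q; rewrite distrC.
have n2 := near_chart_dom dp.
apply: filterS2 n1 n2 => q qr dq.
have C'0 : 0 <= C * r' by rewrite mulr_ge0 ?(ltW C0) ?(ltW r'0).
have h1 := dist_extend x aphi C'0 (sb _ qr).
have h2 := dist_extend x aphi C'0 (segment_bound_sym hg (sb _ qr)).
by rewrite !chart_mapK// in h1 h2.
Qed.

Hypothesis hM : connected [set: M].
(** By [near_dist_extend] the points at finite distance from x form an open and closed set. *)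
Lemma dist_fin x x' : dist g x x' \is a fin_num.
Proof.
rewrite ge0_fin_numE ?dist_ge0//.
pose B := [set q | (dist g x q < +oo)%E].
suff BT : B = [set: M] by have : [set: M] x' by []; rewrite -BT.
apply: hM.
- by exists x; rewrite /B /= dist_xx ltry.
- exists B; rewrite ?setTI// openE => p; rewrite /B /= => xp.
  have [C [C0 /(_ x) H]] := near_dist_extend p.
  rewrite /interior; apply: filterS H => q [h _]; apply: le_lt_trans h _.
  by rewrite lte_add_pinfty// ltry.
- exists B; rewrite ?setTI// -openC openE => p; rewrite /B /= => /negP.
  rewrite -leNgt => xp.
  have [C [C0 /(_ x) H]] := near_dist_extend p.
  rewrite /interior; apply: filterS H => q [_ h] /= xq.
  have := le_lt_trans (le_trans xp h) (lte_add_pinfty xq (ltry C)).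
  by rewrite ltxx.
Qed.

Definition rdist x x' : R := fine (dist g x x').
Lemma rdistE x x' : dist g x x' = (rdist x x')%:E.
Proof. by rewrite fineK// dist_fin. Qed.

Lemma rdist_ge0 x x' : 0 <= rdist x x'.
Proof. by rewrite fine_ge0// dist_ge0. Qed.

Lemma rdist_xx x : rdist x x = 0.
Proof. by rewrite /rdist dist_xx. Qed.

Lemma nonexpansive_rdist x p : nonexpansive_at g (rdist x) p.
Proof.
have [phi [r [aphi dp r0 rc]]] := chart_ball p.
exists phi, r; split=> // y1 y2 S _ _ S0 Sb.
by rewrite lerBlDl -lee_fin EFinD -!rdistE; exact: dist_extend.
Qed.

Lemma rdist_dist x p q : `|rdist x q - rdist x p| <= rdist p q.
Proof. by rewrite -lee_fin -rdistE; apply: nonexpansive_le_dist => ?; exact: nonexpansive_rdist. Qed.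

Lemma rdist_triangle q x p : rdist x p <= rdist x q + rdist q p.
Proof.
by rewrite -lerBlDl; apply: le_trans (rdist_dist x q p); exact: ler_norm.
Qed.

Lemma rdistC x p : rdist x p = rdist p x.
Proof.
(* This is |d(a, a) - d(a, b)| <= d(b, a). *)
have H a b : rdist a b <= rdist b a.
  by have := rdist_dist a b a; rewrite rdist_xx sub0r normrN (ger0_norm (rdist_ge0 _ _)).
by apply/eqP; rewrite eq_le !H.
Qed.

Lemma near_rdist x e : 0 < e -> \forall q \near x, rdist x q < e.
Proof.
move=> e0; have [phi [r [aphi dp r0 rc H]]] := nonexpansive_rdist x x.
have [C [r' [C0 r'0 r'r HC]]] := nonexpansive_lipschitz hg aphi dp r0 rc H.
have eC0 : 0 < Num.min r' (e / C) by rewrite lt_min r'0 divr_gt0.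
have n1 : \forall q \near x, `|phi q - phi x| < Num.min r' (e / C).
  have := chart_map_cont dp => /cvgrPdist_lt /(_ _ eC0).
  by apply: filterS => q; rewrite distrC.
apply: filterS2 n1 (near_chart_dom dp) => q; rewrite lt_min => /andP[q1 q2] dq.
have := HC (phi x) (phi q); rewrite subrr normr0 !chart_mapK// rdist_xx subr0.
rewrite (ger0_norm (rdist_ge0 _ _)) => /(_ r'0 q1) h; apply: le_lt_trans h _.
by rewrite mulrC -ltr_pdivlMr.
Qed.

(* The function c min(r, |phi - phi x|) of a chart phi at x, extended by c r, is
   nonexpansive, hence a lower bound for the distance to x. *)
Lemma nbhs_rdist x (V : set M) : nbhs x V ->
  exists2 e, 0 < e & forall q, rdist x q < e -> V q.
Proof.
move=> nV; pose phi := chart_at x.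
have aphi : atlas phi := chart_at_atlas x; have dx := chart_at_dom x : chart_dom phi x.
have cx := chart_cod_map dx.
have [c c0 lower] := chart_sqnorm_lower hg aphi cx.
have nV' : \forall y \near phi x, V (chart_inv phi y).
  by apply: (chart_inv_cont cx); rewrite chart_mapK.
have nall : \forall y \near phi x, (forall w, c ^+ 2 * `|w| ^+ 2 <= chart_sqnorm g phi y w) /\
    (chart_cod phi y /\ V (chart_inv phi y)).
  exact: filterI lower (filterI (near_chart_cod cx) nV').
have /nbhs_ballP[r0 /= r00 Hr0] := nall.
have {}Hr0 y : `|y - phi x| < r0 -> [/\ forall w, c ^+ 2 * `|w| ^+ 2 <= chart_sqnorm g phi y w,
    chart_cod phi y & V (chart_inv phi y)].
  by move=> yr; have [|h1 [h2 h3]] := Hr0 y; first by rewrite -ball_normE /= distrC.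
pose r := r0 / 2; have rp : 0 < r by rewrite divr_gt0.
have rr0 : r < r0 by rewrite /r ltr_pdivrMr// ltr_pMr// ltr1n.
pose KK := [set q | chart_dom phi q /\ `|phi q - phi x| <= r].
pose h q := if pselect (KK q) then `|phi q - phi x| else r.
(* h has to be constant near each point outside KK. As the image of a compact ball, KK is compact,
   hence closed in the Hausdorff space M. *)
have cK : closed KK.
  apply: compact_closed; first exact: manifold_hausdorff.
  have -> : KK = chart_inv phi @` [set y | `|y - phi x| <= r].
    apply/seteqP; split=> [q [dq qr]|_ [y /= yr <-]].
      by exists (phi q) => //; rewrite chart_mapK.
    have [_ cy _] := Hr0 y (le_lt_trans yr rr0).
    by split; [exact: chart_inv_dom|rewrite chart_invK].
  apply: continuous_compact.
    apply: continuous_in_subspaceT => y /set_mem /= yr; apply: chart_inv_cont.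
    by have [] := Hr0 y (le_lt_trans yr rr0).
  exact: compact_closed_ball_row.
have h_chart y : chart_cod phi y -> h (chart_inv phi y) = Num.min r `|y - phi x|.
  move=> cy; rewrite /h; case: pselect => /= [[_]|nK].
    by rewrite chart_invK// => yr; rewrite (min_idPr yr).
  apply/esym/min_idPl; rewrite leNgt; apply/negP => yr; apply: nK.
  by split; [exact: chart_inv_dom|rewrite chart_invK// ltW].
have hne q : nonexpansive_at g (fun q => c * h q) q.
  have [[dq qr]|nK] := pselect (KK q).
    (* The ball of radius r0 - r around phi q lies in the ball of radius r0 around phi x, where the
       lower bound of the metric holds. *)
    exists phi, (r0 - r); split => //; first by rewrite subr_gt0.
      move=> y yq; have [] := Hr0 y; last by [].
      rewrite -(subrK (phi q) y) -addrA; apply: le_lt_trans (ler_normD _ _) _.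
      by rewrite -(subrK r r0) ltr_leD.
    have inr y : `|y - phi q| < r0 - r -> `|y - phi x| < r0.
      move=> yq; rewrite -(subrK (phi q) y) -addrA; apply: le_lt_trans (ler_normD _ _) _.
      by rewrite -(subrK r r0) ltr_leD.
    move=> y1 y2 S /inr h1 /inr h2 S0 Sb.
    have [low1 c1 _] := Hr0 _ h1; have [_ c2 _] := Hr0 _ h2.
    rewrite !h_chart// -mulrBr.
    have [|_] := Sb 0; first by rewrite lexx ler01.
    rewrite /line scale0r addr0 => /(le_trans (low1 _)).
    rewrite -exprMn ler_pXn2r ?nnegrE ?mulr_ge0 ?(ltW c0)// => /(le_trans _); apply.
    rewrite ler_pM2l//.
    have tri : `|y2 - phi x| <= `|y2 - y1| + `|y1 - phi x|.
      by rewrite -{1}(subrK y1 y2) -addrA; exact: ler_normD.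
    have n0 := normr_ge0 (y2 - y1).
    rewrite lerBlDr; have [l1|l1] := leP r `|y1 - phi x|.
      by rewrite ge_min lerDr n0.
    by rewrite ge_min tri orbT.
  have nKq : nbhs q (~` KK) by apply: open_nbhs_nbhs; split=> //; exact: closed_openC.
  have [psi [r1 [apsi dq r10 rc]]] := chart_ball q.
  have ncp : \forall y \near psi q, (~` KK) (chart_inv psi y).
    by apply: (chart_inv_cont (chart_cod_map dq)); rewrite chart_mapK.
  have /nbhs_ballP[r2 /= r20 Hr2] := ncp.
  exists psi, (Num.min r1 r2); split => //; first by rewrite lt_min r10.
    by move=> y; rewrite lt_min => /andP[/rc].
  have hr y : `|y - psi q| < Num.min r1 r2 -> h (chart_inv psi y) = r.
    rewrite lt_min => /andP[_ yr]; rewrite /h; case: pselect => //= ky.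
    by have := Hr2 y; rewrite -ball_normE /= distrC => /(_ yr) /(_ ky).
  by move=> y1 y2 S h1 h2 S0 _; rewrite !hr// subrr.
exists (c * r); first by rewrite mulr_gt0.
move=> q qc; have := nonexpansive_le_dist x q hne; rewrite rdistE lee_fin.
have -> : h x = 0.
  rewrite /h; case: pselect => /= [_|]; first by rewrite subrr normr0.
  by case; split=> //; rewrite subrr normr0 ltW.
rewrite mulr0 subr0 => /le_lt_trans /(_ qc); rewrite normrM (ger0_norm (ltW c0)) ltr_pM2l//.
rewrite /h; case: pselect => /= [[dq qr] _|_]; last by rewrite (ger0_norm (ltW rp)) ltxx.
by have [_ _] := Hr0 (phi q) (le_lt_trans qr rr0); rewrite chart_mapK.
Qed.
End distance.

(** * Lower bound for the Lagrangian *)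

Lemma is_derive_quadratic (R : realType) (a b s : R) :
  is_derive s 1 (fun t => a * t + b * t ^+ 2) (a + 2 * b * s).
Proof.
apply: is_derive_eq.
rewrite ?scaler0 ?addr0 ?scaler1 ?expr1 /=.
have -> : b *: (s + s) = b * (s + s) by [].
ring.
Qed.

Lemma young_linear (R : realType) (a b N : R) : 0 < a ->
  b * N <= a / 4 * N ^+ 2 + b ^+ 2 / a.
Proof.
move=> a0; have h := sqr_ge0 (a * N / 2 - b).
rewrite -(ler_pM2l a0) mulrDr [a * (b ^+ 2 / a)]mulrC divfK ?gt_eqF//; lra.
Qed.

Section lagrangian.
Variables (R : realType) (m : nat) (M : manifold R m.+1).
Local Notation n := m.+1.
Implicit Types (phi psi : chart R n M) (x p : M) (y w : 'rV[R]_n).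
Variable g : forall x : M, tangent x -> tangent x -> R.
Hypothesis hg : riemannian_metric g.
Lemma tvec_chart_at x (w : 'rV[R]_n) :
  'd (chart_at x \o chart_inv (chart_at x)) (chart_at x x) w = w.
Proof.
have cx := chart_cod_map (chart_at_dom x).
have E : {near chart_at x x, chart_at x \o chart_inv (chart_at x) =1 id}.
  by apply: filterS (near_chart_cod cx) => y' cy' /=; rewrite chart_invK.
have di : differentiable (id : 'rV[R]_n -> 'rV[R]_n) (chart_at x x) by [].
have d1 : differentiable (chart_at x \o chart_inv (chart_at x)) (chart_at x x).
  apply: transition_differentiable => //; try exact: chart_at_atlas.
  by rewrite chart_mapK; exact: chart_at_dom.
by rewrite (near_eq_diff _ d1 E di) diff_val.
Qed.

Lemma chart_sqnorm_at x (w : 'rV[R]_n) :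
  chart_sqnorm g (chart_at x) (chart_at x x) w = g (w : tangent x) (w : tangent x).
Proof.
rewrite /chart_sqnorm /tvec (chart_mapK (chart_at_dom x)).
by rewrite (tvec_chart_at x w).
Qed.

Lemma gnormZ x (a : R) (v : 'rV[R]_n) :
  gnorm g (a *: v : tangent x) = `|a| * gnorm g (v : tangent x).
Proof.
rewrite /gnorm -!chart_sqnorm_at (chart_sqnormZ hg) sqrtrM ?sqr_ge0// sqrtr_sqr.
by [].
Qed.

Lemma norm_le_gnorm x : exists2 c, 0 < c &
  forall v : 'rV[R]_n, c * `|v| <= gnorm g (v : tangent x).
Proof.
have [c c0 H] := chart_sqnorm_lower hg (chart_at_atlas x) (chart_cod_map (chart_at_dom x)).
exists c => // v; have := nbhs_singleton H v; rewrite chart_sqnorm_at => h.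
rewrite /gnorm -[leLHS]ger0_norm ?mulr_ge0 ?(ltW c0)// -sqrtr_sqr exprMn ler_sqrt//.
exact: (metric_ge0 hg).
Qed.

Variable L : forall x : M, tangent x -> R.
Hypothesis hL : C1_lagrangian L.
Lemma lagrangian_differentiable x (v : 'rV[R]_n) :
  differentiable (L (x := x) : 'rV[R]_n -> R) v.
Proof.
set phi := chart_at x; have aphi : atlas phi := chart_at_atlas x.
have [H _] := hL aphi.
have dH := H (phi x, v) (chart_cod_map (chart_at_dom x)).
have dp : differentiable (fun u : 'rV[R]_n => (phi x, u)) v.
  exact: differentiable_pair.
have := @differentiable_comp _ _ _ _ (fun u : 'rV[R]_n => (phi x, u))
  (fun yu => local_rep L phi yu.1 yu.2) v dp dH.
suff -> : (fun yu : 'rV[R]_n * 'rV[R]_n => local_rep L phi yu.1 yu.2) \o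
    (fun u : 'rV[R]_n => (phi x, u)) = (L (x := x) : 'rV[R]_n -> R) by [].
apply/funext => u; rewrite /= /local_rep /tvec (chart_mapK (chart_at_dom x)).
by rewrite (tvec_chart_at x u).
Qed.

Lemma is_derive_lagrangian x (v w : 'rV[R]_n) (s : R) :
  is_derive s 1 (fun t => L (line v w t : tangent x))
    ('d (L (x := x) : 'rV[R]_n -> R) (line v w s) w).
Proof.
have dl := differentiable_line v w s.
have dL := lagrangian_differentiable x (line v w s).
have dc : differentiable ((L (x := x) : 'rV[R]_n -> R) \o line v w) s by exact: differentiable_comp.
apply: DeriveDef; first exact/derivable1_diffP.
rewrite -[X in 'D_1 X s]/((L (x := x) : 'rV[R]_n -> R) \o line v w).
by rewrite deriveE// -(diff_compE _ dl dL) diff_line scale1r.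
Qed.

Lemma dvE x (v w : 'rV[R]_n) :
  dv L (v : tangent x) w = 'd (L (x := x) : 'rV[R]_n -> R) v w.
Proof.
rewrite /dv derive1E; have [_ ->] := is_derive_lagrangian x v w 0.
by rewrite /line scale0r addr0.
Qed.

(** [sup] bounds the elements only of a set that is bounded above; this one is, since the form is
    linear in finite dimension and [norm_le_gnorm] bounds the components of unit vectors.
    Homogeneity does the rest. *)
Lemma dual_norm_bound x (v w : 'rV[R]_n) :
  `|dv L (v : tangent x) w| <= dual_norm g (dv L (v : tangent x)) * gnorm g (w : tangent x).
Proof.
pose l : 'rV[R]_n -> R := 'd (L (x := x) : 'rV[R]_n -> R) v.
have lE u : dv L (v : tangent x) u = l u by exact: dvE.
have lZ a u : l (a *: u) = a * l u by rewrite /l linearZ_LR.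
have lb u : `|l u| <= (\sum_i `|l 'e_i|) * `|u|.
  have -> : l u = \sum_i u 0 i * l 'e_i.
    by rewrite {1}(row_sum_delta u) /l raddf_sum; apply: eq_bigr => i _; exact: linearZ_LR.
  rewrite mulr_suml; apply: le_trans (ler_norm_sum _ _ _) _.
  apply: ler_sum => i _; rewrite normrM mulrC ler_wpM2l//.
  exact: normr_coord.
have [c c0 Hc] := norm_le_gnorm x.
set A := [set `|dv L (v : tangent x) w| | w in [set w : tangent x | gnorm g w <= 1]].
have supA : has_sup A.
  split.
    exists `|l 0|, (0 : 'rV[R]_n); last by rewrite lE.
    by rewrite /= -(scale0r (0 : 'rV[R]_n)) gnormZ normr0 mul0r ler01.
  exists ((\sum_i `|l 'e_i|) / c) => _ [u /= u1 <-]; rewrite lE; apply: le_trans (lb u) _.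
  rewrite ler_wpM2l ?sumr_ge0// -[leRHS]mul1r ler_pdivlMr// mulrC.
  exact: le_trans (Hc u) u1.
have [w0|w0] := eqVneq (gnorm g (w : tangent x)) 0.
  have wz : w = 0.
    apply/eqP; rewrite -normr_eq0; apply/eqP/le_anti; rewrite normr_ge0 andbT.
    by have := Hc w; rewrite w0 pmulr_rle0.
  by rewrite lE wz -(scale0r (0 : 'rV[R]_n)) lZ mul0r normr0 gnormZ normr0 mul0r mulr0.
have wp : 0 < gnorm g (w : tangent x) by rewrite lt_neqAle eq_sym w0 sqrtr_ge0.
rewrite -ler_pdivrMr//; apply: sup_upper_bound => //.
exists ((gnorm g (w : tangent x))^-1 *: w); first by rewrite /= gnormZ normfV gtr0_norm// mulVf ?gt_eqF.
by rewrite !lE lZ normrM normfV (gtr0_norm wp) mulrC.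
Qed.

Section lower_bound.
Variables (K : forall x : M, tangent x) (Q : forall x : M, tangent x -> R).
Hypothesis Qlin : forall x (a : R) (v w : 'rV[R]_n),
  Q (a *: v + w : tangent x) = a * Q (v : tangent x) + Q (w : tangent x).
Let QZ x (a : R) (v : 'rV[R]_n) : Q (a *: v : tangent x) = a * Q (v : tangent x).
Proof.
have Q0 : Q (0 : tangent x) = 0.
  have := @Qlin x 1 0 0; rewrite scaler0 addr0 mul1r => /eqP.
  by rewrite -subr_eq subrr eq_sym => /eqP.
by have := @Qlin x a v 0; rewrite addr0 Q0 addr0.
Qed.

Let ray x (v : 'rV[R]_n) (s : R) := L_c L K Q (s *: v : tangent x).
Let dray x (v : 'rV[R]_n) (s : R) : R := 'd (L (x := x) : 'rV[R]_n -> R) (s *: v) v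
  - 2 * s * (Q (v : tangent x) ^+ 2 / Q (K x)).
Let is_derive_ray x (v : 'rV[R]_n) (s : R) : is_derive s 1 (ray x v) (dray x v s).
Proof.
have E : ray x v = (fun t => L (line 0 v t : tangent x)) \-
    (fun t => 0 * t + (Q (v : tangent x) ^+ 2 / Q (K x)) * t ^+ 2).
  apply/funext => t; rewrite /ray /L_c /= /line add0r QZ exprMn; ring.
have -> : dray x v s = 'd (L (x := x) : 'rV[R]_n -> R) (line 0 v s) v -
    (0 + 2 * (Q (v : tangent x) ^+ 2 / Q (K x)) * s).
  by rewrite /dray /line !add0r; congr (_ - _); ring.
rewrite E; apply: is_deriveB; last exact: is_derive_quadratic.
exact: is_derive_lagrangian.
Qed.

(* Integrates the strong monotonicity of the fibre derivative along the ray
   from 0 to v. *)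
Lemma strong_convexity x (lam : R) :
  (forall v1 v2 : 'rV[R]_n, lam * gnorm g (v2 - v1 : tangent x) ^+ 2 <=
     dv (L_c L K Q) (v2 : tangent x) (v2 - v1) - dv (L_c L K Q) (v1 : tangent x) (v2 - v1)) ->
  forall v : 'rV[R]_n, L (0 : tangent x) + dv L (0 : tangent x) v +
    lam / 2 * gnorm g (v : tangent x) ^+ 2 <= L_c L K Q (v : tangent x).
Proof.
move=> mono v; set N := gnorm g (v : tangent x).
have dvray (s t : R) : dv (L_c L K Q) (s *: v : tangent x) (t *: v) = t * dray x v s.
  rewrite /dv derive1E.
  have E : (fun h => L_c L K Q (s *: v + h *: (t *: v) : tangent x)) = ray x v \o line s t.
    apply/funext => h; rewrite /ray /= /line; congr (L_c _ _ _ _).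
    by rewrite scalerA -scalerDl.
  rewrite E; have d1 := is_derive_line s t 0.
  have d2 := is_derive_ray x v (line s t 0).
  have := @is_derive1_comp _ (ray x v) (line s t) 0 _ _ d2 d1.
  by move=> [_ ->]; rewrite mulrC /line scale0r addr0.
have dmono (s : R) : 0 < s -> lam * s * N ^+ 2 <= dray x v s - dray x v 0.
  move=> s0; have e : s *: v - 0 *: v = s *: v by rewrite scale0r subr0.
  have := mono (0 *: v) (s *: v); rewrite e !dvray -mulrBr gnormZ.
  rewrite (gtr0_norm s0) exprMn expr2 -/N => h.
  by rewrite -(ler_pM2l s0); apply: le_trans h; rewrite le_eqVlt; apply/orP; left; apply/eqP; ring.
(* By [dmono] the derivative of chi is nonnegative on ]0, 1[, and chi 0 <= chi 1 is the claim. *)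
pose chi := ray x v \- (fun s => dray x v 0 * s + lam / 2 * N ^+ 2 * s ^+ 2).
have dchi (s : R) : is_derive s 1 chi (dray x v s - (dray x v 0 + lam * s * N ^+ 2)).
  have -> : dray x v 0 + lam * s * N ^+ 2 = dray x v 0 + 2 * (lam / 2 * N ^+ 2) * s.
    by congr (_ + _); field.
  by apply: is_deriveB; [exact: is_derive_ray|exact: is_derive_quadratic].
have [c c01 chiE] : exists2 c, c \in `]0, 1[ &
    chi 1 - chi 0 = (dray x v c - (dray x v 0 + lam * c * N ^+ 2)) * (1 - 0).
  apply: MVT => //.
  apply: continuous_in_subspaceT => s _; apply: differentiable_continuous.
  by apply/derivable1_diffP; case: (dchi s).
move: c01; rewrite in_itv/= => /andP[c0 c1]; have := dmono c c0 => hc.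
(* The correction by Q is quadratic, so L_c and L share value and fibre derivative at zero velocity;
   thus the bounds of (B) on L can be used. *)
have ray1 : ray x v 1 = L_c L K Q (v : tangent x) by rewrite /ray scale1r.
have ray0 : ray x v 0 = L (0 : tangent x).
  by rewrite /ray /L_c QZ mul0r expr2 mul0r mul0r subr0 scale0r.
have d0 : dray x v 0 = dv L (0 : tangent x) v.
  by rewrite dvE /dray scale0r mulr0 mul0r subr0.
rewrite -ray1 -ray0 -d0; move: chiE hc; rewrite /chi /=.
move: (ray x v 1) (ray x v 0) (dray x v c) (dray x v 0) (N ^+ 2) => a1 a0 b1 b0 k.
by move=> {mono dmono chi dchi ray1 ray0 d0} ? ?; lra.
Qed.

Lemma lagrangian_lower_bound (d lam : M -> R) (b0 : R) : (forall x, Q (K x) < 0) ->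
  (forall x (v1 v2 : 'rV[R]_n), lam x * gnorm g (v2 - v1 : tangent x) ^+ 2 <=
     dv (L_c L K Q) (v2 : tangent x) (v2 - v1) - dv (L_c L K Q) (v1 : tangent x) (v2 - v1)) ->
  condition_B g L K Q d lam ->
  exists alpha beta, 0 < alpha /\ forall x (v : tangent x), `|Q v| <= b0 ->
    alpha * gnorm g v ^+ 2 - beta <= L v.
Proof.
move=> QK mono [c1 [c2 [c3 [k1 [k2 [c10 k10 HB]]]]]].
(* With N = |v|, convexity and (B) give L_c >= c2 - c3 N + (c1 / 2) N^2. Half of the quadratic term
   absorbs the linear one at the cost c3^2 / c1, and passing from L_c to L costs at most b0^2 /
   k1. *)
exists (c1 / 4), (c3 ^+ 2 / c1 - c2 + b0 ^+ 2 / k1); split; first by rewrite divr_gt0.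
move=> x v Qb; have [lc Lc2 dLc3 Qk _] := HB x.
have := strong_convexity (mono x) v.
have := @dual_norm_bound x 0 v.
set N := gnorm g v => dL; rewrite /L_c => sc.
have N0 : 0 <= N by exact: sqrtr_ge0.
have {}dL : - (c3 * N) <= dv L (0 : tangent x) v.
  have := le_trans dL (ler_wpM2r N0 dLc3).
  by rewrite ler_norml => /andP[].
have Q2 : - (Q v ^+ 2 / Q (K x)) <= b0 ^+ 2 / k1.
  have QK' : 0 < - Q (K x) by rewrite oppr_gt0.
  rewrite -mulrN -invrN; apply: ler_pM; rewrite ?sqr_ge0 ?invr_ge0 ?(ltW QK')//.
    by rewrite -(real_normK (num_real (Q v))) ler_pXn2r// nnegrE// (le_trans _ Qb).
  by rewrite lef_pV2.
have lN : c1 / 2 * N ^+ 2 <= lam x / 2 * N ^+ 2.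
  by rewrite ler_wpM2r ?sqr_ge0// ler_pM2r.
have sq : c3 * N <= c1 / 4 * N ^+ 2 + c3 ^+ 2 / c1 by exact: young_linear.
move: sc dL Q2 lN sq Lc2.
move: (Q v ^+ 2 / Q (K x)) (L (0 : tangent x)) (dv L (0 : tangent x) v) (L v) (lam x / 2 * N ^+ 2) (c3 * N) (c3 ^+ 2 / c1) (b0 ^+ 2 / k1).
move=> e1 e2 e3 e4 e5 e6 e7 e8.
have : c1 / 4 * N ^+ 2 + c1 / 4 * N ^+ 2 = c1 / 2 * N ^+ 2 by field.
move: (c1 / 4 * N ^+ 2) (c1 / 2 * N ^+ 2) => e9 e10.
by move=> {mono HB} *; lra.
Qed.
End lower_bound.
End lagrangian.

(** * Ultralimits of equicontinuous curves *)

Lemma add_thirds (R : realFieldType) (e a b c : R) :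
  a < e / 3 -> b < e / 3 -> c < e / 3 -> a + (b + c) < e.
Proof. by move=> *; lra. Qed.

Section ultralimits.
Variables (R : realType) (m : nat) (M : manifold R m.+1).
Local Notation n := m.+1.
Implicit Types (x y p : M) (u : nat -> M).
Variable g : forall x : M, tangent x -> tangent x -> R.
Hypothesis hg : riemannian_metric g.
Hypothesis hM : connected [set: M].
Hypothesis hgc : complete_metric g.
Variable U : set_system nat.
Hypothesis UU : UltraFilter U.
Hypothesis Uoo : \oo `<=` U.
Local Notation rd := (rdist g).
Definition ultralimit u x := forall e, 0 < e -> U [set i | rd x (u i) < e].
Let UP : ProperFilter U := ultra_proper.
Let U_ex (A : set nat) : U A -> exists i, A i.
Proof. exact: filter_ex. Qed.

(** A compact chart neighbourhood of x contains u i for U-many i, so u has a cluster point along U;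
    for an ultrafilter a cluster point is a limit. The radius does not depend on u. *)
Lemma locally_compact_ultralimit x : exists2 r, 0 < r &
  forall u, U [set i | rd x (u i) < r] -> exists y, ultralimit u y.
Proof.
pose phi := chart_at x; have dx : chart_dom phi x := chart_at_dom x.
have /nbhs_ballP[r0 /= r00 Hr0] := near_chart_cod (chart_cod_map dx).
have {}Hr0 (y : 'rV[R]_n) : `|y - phi x| < r0 -> chart_cod phi y.
  by move=> yr; apply: Hr0; rewrite -ball_normE /= distrC.
pose B := [set y : 'rV[R]_n | `|y - phi x| <= r0 / 2].
have r20 : 0 < r0 / 2 by rewrite divr_gt0.
have Bc (y : 'rV[R]_n) : B y -> chart_cod phi y.
  by move=> yB; apply: Hr0; apply: le_lt_trans yB _; rewrite ltr_pdivrMr// ltr_pMr// ltr1n.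
have cB : compact B by exact: compact_closed_ball_row.
have cK : compact (chart_inv phi @` B).
  apply: continuous_compact => //.
  by apply: continuous_in_subspaceT => y /set_mem /Bc; exact: chart_inv_cont.
have nK : nbhs x (chart_inv phi @` B).
  have := chart_map_cont dx => /cvgrPdist_le /(_ _ r20) H.
  apply: filterS2 H (near_chart_dom dx) => q qB dq.
  by exists (phi q); [rewrite /B /= distrC|rewrite chart_mapK].
have [r r_gt0 rK] := nbhs_rdist hg hM nK.
exists r => // u Ur.
have [|y [_ cy]] := cK (u @ U) _; first by apply: filterS Ur => i; exact: rK.
exists y => e e0; have [//|nA] := in_ultra_setVsetC [set i | rd y (u i) < e] UU.
have [q [nq yq]] : [set q | ~ rd y q < e] `&` [set q | rd y q < e] !=set0.
  by apply: cy => //; exact: near_rdist.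
by [].
Qed.

Lemma rdist_complete u : (forall e, 0 < e -> exists k0, forall i j,
    (k0 <= i)%N -> (k0 <= j)%N -> rd (u i) (u j) < e) ->
  exists x, forall e, 0 < e -> exists k0, forall i, (k0 <= i)%N -> rd (u i) x < e.
Proof.
move=> H; have [|x Hx] := hgc (u := u).
  move=> e e0; have [k0 Hk] := H e e0; exists k0 => i j ki kj.
  by rewrite (rdistE hg hM) lte_fin Hk.
exists x => e e0; have [k0 Hk] := Hx e e0; exists k0 => i ki.
by rewrite -lte_fin -(rdistE hg hM) Hk.
Qed.

Variable z : nat -> R -> M.
Hypothesis equi : forall e, 0 < e -> exists2 del, 0 < del & forall i s t,
  0 <= s <= 1 -> 0 <= t <= 1 -> `|s - t| < del -> rd (z i s) (z i t) < e.
Definition converges_at t := exists x, ultralimit (z ^~ t) x.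
(** Let x k be the ultralimit at a time so close to t that equicontinuity leaves an error 1 / (k +
    1). Any two x k, x l are compared through one common z i t, so x is Cauchy, and its limit is the
    ultralimit at t. *)
Lemma converges_at_closed t : 0 <= t <= 1 ->
  (forall del, 0 < del -> exists s, [/\ 0 <= s <= 1, `|s - t| < del & converges_at s]) ->
  converges_at t.
Proof.
move=> t01 H.
have inv0 k : 0 < k.+1%:R^-1 :> R by rewrite invr_gt0.
have /choice [x Hx] : forall k : nat, exists x, forall e, 0 < e ->
    U [set i | rd x (z i t) < k.+1%:R^-1 + e].
  move=> k; have [del del0 Hd] := equi (inv0 k).
  have [s [s01 st [x xs]]] := H del del0.
  exists x => e e0; apply: filterS (xs e e0) => i /= h.
  apply: le_lt_trans (rdist_triangle hg hM (z i s) _ _) _.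
  by rewrite addrC ltrD// Hd.
have xx k l : rd (x k) (x l) <= k.+1%:R^-1 + l.+1%:R^-1.
  apply/ler_addgt0Pr => e e0; have e20 : 0 < e / 2 by rewrite divr_gt0.
  have [i [/= h1 h2]] := U_ex (filterI (Hx k _ e20) (Hx l _ e20)).
  apply: le_trans (rdist_triangle hg hM (z i t) _ _) _.
  rewrite (rdistC hg hM (z i t)); apply: le_trans (lerD (ltW h1) (ltW h2)) _.
  by rewrite addrACA -splitr.
have [|y Hy] := @rdist_complete x.
  move=> e e0; have [k0 _ Hk] : \forall k \near \oo, k.+1%:R^-1 < e / 2.
    by apply: (near_infty_natSinv_lt (PosNum _)); rewrite divr_gt0.
  exists k0 => i j ki kj; apply: le_lt_trans (xx i j) _.
  by rewrite (splitr e) ltrD//; exact: Hk.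
exists y => e e0; have e30 : 0 < e / 3 by rewrite divr_gt0.
have [k1 Hk1] := Hy _ e30.
have [k0 _ Hk] : \forall k \near \oo, k.+1%:R^-1 < e / 3 by exact: (near_infty_natSinv_lt (PosNum e30)).
pose k := maxn k0 k1.
apply: filterS (Hx k _ e30) => i /= h.
apply: le_lt_trans (rdist_triangle hg hM (x k) _ _) _.
have h1 : rd (x k) y < e / 3 by apply: Hk1; exact: leq_maxr.
have h2 : k.+1%:R^-1 < e / 3 by apply: Hk; exact: leq_maxl.
rewrite (rdistC hg hM y).
apply: le_lt_trans (add_thirds h1 h2 (_ : rd (x k) (z i t) - k.+1%:R^-1 < e / 3)).
  by rewrite lerD2l [leRHS]addrCA subrr addr0.
by rewrite ltrBlDl.
Qed.

(** The radius r belongs to the ultralimit x at t: half of it covers the distance from x to z i t,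
    the other half that from z i t to z i s. *)
Lemma converges_at_open t : 0 <= t <= 1 -> converges_at t ->
  exists2 del, 0 < del & forall s, 0 <= s <= 1 -> `|s - t| < del -> converges_at s.
Proof.
move=> t01 [x xt]; have [r r0 Hr] := locally_compact_ultralimit x.
have r20 : 0 < r / 2 by rewrite divr_gt0.
have [del del0 Hd] := equi r20; exists del => // s s01 st; apply: Hr.
apply: filterS (xt _ r20) => i /= h.
apply: le_lt_trans (rdist_triangle hg hM (z i t) _ _) _.
by rewrite (splitr r) ltrD// Hd// distrC.
Qed.

(* Fixing the ultrafilter first makes local compactness sufficient: the set of
   times of convergence is open and closed, and Hopf-Rinow is not needed. *)
Lemma converges_everywhere t : converges_at 0 -> 0 <= t <= 1 -> converges_at t.
Proof.
move=> S0 /andP[t0 t1]; have le1 s : 0 <= s <= t -> 0 <= s <= 1.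
  by move=> /andP[-> st]; rewrite (le_trans st).
apply: (@itv_local_global R 0 t (fun a b => converges_at a -> converges_at b) t0) => //.
  by move=> x y w _ _ _ _ h1 h2 /h1/h2.
move=> x /le1 x01.
(* Either times of convergence come arbitrarily close to x, and all times near x are such, or there
   are none near x and the implication is vacuous. *)
have [near_S|] := pselect (forall del, 0 < del ->
    exists s, [/\ 0 <= s <= 1, `|s - x| < del & converges_at s]).
  have [del del0 Hd] := converges_at_open x01 (converges_at_closed x01 near_S).
  exists del => // a b a0 ab bt xa bx _; apply: Hd.
    by apply: le1; rewrite (le_trans a0).
  by rewrite ltr_distl bx (lt_le_trans xa).
move=> /existsNP[del /not_implyP[del0 nS]]; exists del => // a b a0 ab bt xa bx Sa.
exfalso; apply: nS; exists a; split=> //.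
  by apply: le1; rewrite a0 (le_trans ab).
by rewrite ltr_distl xa (le_lt_trans ab).
Qed.

Hypothesis S0 : converges_at 0.
(** The default point is taken only at times without ultralimit, hence never on [0, 1]. *)
Definition limit_curve t : M := xget (z 0%N 0) [set x | ultralimit (z ^~ t) x].
Lemma limit_curveP t : 0 <= t <= 1 -> ultralimit (z ^~ t) (limit_curve t).
Proof.
move=> /(converges_everywhere S0) [x xt].
exact: (@xgetI _ _ [set x | ultralimit (z ^~ t) x] x).
Qed.

Lemma limit_curve_equi e : 0 < e -> exists2 del, 0 < del & forall s t,
  0 <= s <= 1 -> 0 <= t <= 1 -> `|s - t| < del -> rd (limit_curve s) (limit_curve t) < e.
Proof.
move=> e0; have e30 : 0 < e / 3 by rewrite divr_gt0.
have [del del0 Hd] := equi e30; exists del => // s t s01 t01 st.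
have [i [/= h1 h2]] := U_ex (filterI (limit_curveP s01 e30) (limit_curveP t01 e30)).
have h3 := Hd i s t s01 t01 st.
apply: le_lt_trans (rdist_triangle hg hM (z i s) _ _) _.
have h4 := rdist_triangle hg hM (z i t) (z i s) (limit_curve t).
rewrite (rdistC hg hM (z i t)) in h4.
apply: le_lt_trans (add_thirds h1 h3 h2).
by rewrite lerD2l.
Qed.

Lemma limit_curve_continuous : {within `[0, 1], continuous limit_curve}.
Proof.
apply/subspace_continuousP => t; rewrite /= in_itv /= => t01 V /(nbhs_rdist hg hM)[e e0 HV].
have [del del0 Hd] := limit_curve_equi e0.
apply/nbhs_ballP; exists del => // s ts; rewrite /= in_itv /= => s01.
by apply: HV; apply: Hd.
Qed.

(** U is stable under finite intersections, so convergence is simultaneous on a finite grid;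
    equicontinuity of the curves and of the limit covers the times in between. *)
Lemma uniform_ultralimit e : 0 < e ->
  U [set i | forall t, 0 <= t <= 1 -> rd (z i t) (limit_curve t) < e].
Proof.
move=> e0; have e30 : 0 < e / 3 by rewrite divr_gt0.
have [d1 d10 Hd1] := equi e30; have [d2 d20 Hd2] := limit_curve_equi e30.
pose del := Num.min d1 d2; have del0 : 0 < del by rewrite lt_min d10.
have [N _ /(_ N (leqnn _)) HN] : \forall k \near \oo, k.+1%:R^-1 < del :> R.
  exact: (near_infty_natSinv_lt (PosNum del0)).
have N0 : 0 < N.+1%:R :> R by [].
(* There are N + 2 grid points, since the truncation of t (N + 1) reaches N + 1 at t = 1. *)
pose grid (j : 'I_N.+2) : R := j%:R / N.+1%:R.
have grid01 j : 0 <= grid j <= 1.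
  rewrite /grid divr_ge0//= ler_pdivrMr// mul1r ler_nat; exact: ltn_ord j.
have : U [set i | forall j, rd (limit_curve (grid j)) (z i (grid j)) < e / 3].
  apply: (@filter_forall _ 'I_N.+2 (fun j i => rd (limit_curve (grid j)) (z i (grid j)) < e / 3) U _).
  by move=> j; exact: limit_curveP.
apply: filterS => i /= Hi t t01.
have [j jt] : exists j, `|t - grid j| < del.
  have [t0 t1] := andP t01.
  have tN0 : 0 <= t * N.+1%:R by rewrite mulr_ge0.
  have /andP[j1 j2] := truncn_itv tN0.
  have jN : (Num.trunc (t * N.+1%:R) < N.+2)%N.
    rewrite -(ltr_nat R); apply: le_lt_trans j1 _.
    apply: (@le_lt_trans _ _ N.+1%:R); last by rewrite ltr_nat.
    by rewrite ler_piMl.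
  exists (Ordinal jN); apply: le_lt_trans HN.
  rewrite /grid /= ger0_norm ?subr_ge0 ?ler_pdivrMr//.
  by rewrite lerBlDr -[X in _ <= X + _]mul1r -mulrDl ler_pdivlMr// addrC natr1 ltW.
move: jt; rewrite lt_min => /andP[jt1 jt2].
have h1 := Hd1 i t (grid j) t01 (grid01 j) jt1.
have h2 := Hd2 (grid j) t (grid01 j) t01; rewrite distrC in h2; have {}h2 := h2 jt2.
have h3 := Hi j.
apply: le_lt_trans (rdist_triangle hg hM (z i (grid j)) _ _) _.
have h4 := rdist_triangle hg hM (limit_curve (grid j)) (z i (grid j)) (limit_curve t).
rewrite (rdistC hg hM (z i (grid j)) (limit_curve (grid j))) in h4.
apply: le_lt_trans (add_thirds h1 h3 h2).
by rewrite lerD2l.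
Qed.

(** U contains all tails, so an index accurate to 1 / (k + 1) can be picked beyond the preceding
    one. *)
Lemma uniform_subsequence : exists sigma : nat -> nat,
  {homo sigma : i j / (i < j)%N} /\
  forall e, 0 < e -> exists i0, forall i, (i0 <= i)%N -> forall t, 0 <= t <= 1 ->
    rd (z (sigma i) t) (limit_curve t) < e.
Proof.
have inv0 k : 0 < k.+1%:R^-1 :> R by rewrite invr_gt0.
have /choice [pick Hpick] : forall kN : nat * nat, exists i, (kN.2 < i)%N /\
    forall t, 0 <= t <= 1 -> rd (z i t) (limit_curve t) < kN.1.+1%:R^-1.
  move=> [k N] /=.
  have UN : U [set i | (N < i)%N] by apply: Uoo; exact: nbhs_infty_gt.
  have [i [h1 h2]] := U_ex (filterI UN (uniform_ultralimit (inv0 k))).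
  by exists i.
pose fix sigma i := if i is j.+1 then pick (i, sigma j) else pick (0%N, 0%N).
exists sigma; split.
  by apply: homo_ltn => [i j k|i]; [exact: ltn_trans|have [] := Hpick (i.+1, sigma i)].
move=> e e0.
have [k0 _ Hk] : \forall k \near \oo, k.+1%:R^-1 < e by exact: (near_infty_natSinv_lt (PosNum e0)).
exists k0 => i ki t t01; apply: lt_trans (Hk i ki).
by case: i {ki} => [|i]; [have [_] := Hpick (0%N, 0%N)|have [_] := Hpick (i.+1, sigma i)]; exact.
Qed.
End ultralimits.

(** * Equicontinuity of the sublevels of the action *)

Section energy.
Variables (R : realType) (m : nat) (M : manifold R m.+1).
Variable g : forall x : M, tangent x -> tangent x -> R.
Hypothesis hg : riemannian_metric g.
Hypothesis hM : connected [set: M].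
Variables (L : forall x : M, tangent x -> R) (K : forall x : M, tangent x).
Variables (Q : forall x : M, tangent x -> R) (d C lambda : M -> R).
Hypotheses (hS : condition_S L K Q d) (hG : condition_G g L K Q C lambda).
Hypothesis hB : condition_B g L K Q d lambda.
Variables (p q : M) (c b : R).
Hypothesis Nb : forall z, Jsub g L K p q c z ->
  forall k, noether_constant L K z k -> `|k| <= b.
Lemma Jsub_energy_bound : exists alpha beta, 0 < alpha /\
  forall z, Jsub g L K p q c z -> forall s t kap, 0 < kap -> 0 <= s -> s <= t -> t <= 1 ->
    rdist g (z s) (z t) <= kap * (t - s) + (c + beta) / (alpha * kap).
Proof.
have [hL [_ _ [Qlin _] _ hN] _ QK] := hS.
have [_ _ _ _ mono] := hG.
have [c1 [c2 [c3 [k1 [k2 [_ _ HB]]]]]] := hB.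
(* b + k2 bounds |Q(z')| = |k - d(z)|. *)
have [alpha [beta [al0 low]]] := lagrangian_lower_bound hg hL Qlin (b + k2) QK
  (fun x v1 v2 => mono x v1 v2) hB.
exists alpha, beta; split=> // z Jz s t kap kap0 s0 st t1.
have [[[acz _ _ _] [k Nk]] Az] := Jz.
have kb := Nb Jz Nk.
have acz' : ac_curve_on 0 1 z by exact: acz.
(* The test function is the distance to z s, whose increment from s to t is the distance to be
   estimated. *)
have bound := curve_bound hg (nonexpansive_rdist hg hM (z s)) ler01 acz'.
have := ae_derivative_bound_energy bound al0 kap0 _ Az s0 st t1 (beta := beta).
rewrite /= rdist_xx subr0 (ger0_norm (rdist_ge0 _ _ _)); apply.
move: Nk; apply: filterS; first exact: (ae_filter_ringOfSetsType (@lebesgue_measure R)).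
move=> u Nu /andP[u0 u1]; apply: low.
have := Nu; rewrite in_itv/= (ltW u0) (ltW u1) => /(_ isT); rewrite hN => /eqP.
rewrite eq_sym -subr_eq => /eqP <-.
apply: le_trans (ler_normB _ _) _; rewrite lerD//.
by have [_ _ _ _ ->] := HB (z u).
Qed.

Lemma Jsub_equicontinuous e : 0 < e -> exists2 del, 0 < del &
  forall z, Jsub g L K p q c z -> forall s t, 0 <= s <= 1 -> 0 <= t <= 1 ->
    `|s - t| < del -> rdist g (z s) (z t) < e.
Proof.
move=> e0; have [alpha [beta [al0 H]]] := Jsub_energy_bound.
pose E := `|c + beta| / alpha; have E0 : 0 <= E by rewrite divr_ge0// ltW.
(* This makes E / kap, which bounds the second term, smaller than e / 2; the summand 1 keeps kap
   positive and the inequality strict. *)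
pose kap := (E + 1) / (e / 2).
have e20 : 0 < e / 2 by rewrite divr_gt0.
have kap0 : 0 < kap by rewrite divr_gt0// ltr_wpDl.
exists (e / 2 / kap); first by rewrite divr_gt0.
move=> z Jz.
have main s t : 0 <= s -> s <= t -> t <= 1 -> t - s < e / 2 / kap -> rdist g (z s) (z t) < e.
  move=> s0 st t1 ts; apply: le_lt_trans (H z Jz s t kap kap0 s0 st t1) _.
  rewrite (splitr e); apply: ltrD; first by rewrite mulrC -ltr_pdivlMr.
  apply: (@le_lt_trans _ _ (E / kap)).
    rewrite invfM mulrA ler_wpM2r ?invr_ge0 ?(ltW kap0)// ler_wpM2r ?invr_ge0 ?(ltW al0)//.
    exact: ler_norm.
  rewrite ltr_pdivrMr// mulrC /kap divfK ?gt_eqF//; by rewrite ltrDl.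
move=> s t /andP[s0 s1] /andP[t0 t1] st; have [le|lt] := leP s t.
  by apply: main => //; rewrite distrC ger0_norm ?subr_ge0// in st.
rewrite (rdistC hg hM); apply: main => //; first exact: ltW.
by rewrite ger0_norm ?subr_ge0 ?(ltW lt) in st.
Qed.
End energy.

Theorem proposition7p2 (R : realType) (m : nat) (hm : (1 <= m)%N)
    (M : manifold R m.+1) (hM : connected [set: M])
    (g : forall x : M, tangent x -> tangent x -> R)
    (hg : riemannian_metric g) (hgc : complete_metric g)
    (L : forall x : M, tangent x -> R)
    (K : forall x : M, tangent x) (Q : forall x : M, tangent x -> R)
    (d C lambda : M -> R)
    (hS : condition_S L K Q d) (hG : condition_G g L K Q C lambda)
    (hB : condition_B g L K Q d lambda)
    (p q : M) (c : R) :
  c_bounded g L K p q c -> c_precompact g L K p q c.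
Proof.
move=> [_ [b Nb]] z Jz.
have [U [UU Uoo]] := ultraFilterLemma (F := \oo) _.
have equi e : 0 < e -> exists2 del, 0 < del & forall i s t,
    0 <= s <= 1 -> 0 <= t <= 1 -> `|s - t| < del -> rdist g (z i s) (z i t) < e.
  move=> e0; have [del del0 H] := Jsub_equicontinuous hg hM hS hG hB Nb e0.
  by exists del => // i; exact: H.
have z0 i : z i 0 = p by have [[[]]] := Jz i.
have S0 : converges_at g U z 0.
  exists p => e e0; apply: filterS (filterT : U setT) => i _.
  by rewrite /= z0 rdist_xx.
have [sigma [sigma_lt sigma_cvg]] := uniform_subsequence hg hM hgc UU Uoo equi S0.
exists sigma, (limit_curve g U z); split=> //.
  exact: limit_curve_continuous.
move=> e e0; have [i0 Hi0] := sigma_cvg e e0; exists i0 => i ii0 t.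
by rewrite in_itv /= (rdistE hg hM) lte_fin => t01; exact: Hi0.
Qed.
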